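(* Let $k$ be a field of characteristic zero, let $m\in\mathbb{N}$ (a positive integer) and let $p\in k[t]$ with $p\neq 0$. Then $$\mu(\mathfrak{h}_{m,p}) = m\deg p + \left\lceil 2\sqrt{\deg p}\,\right\rceil .$$
   Context: All Lie algebras, associative algebras and tensor products are over the field $k$. For a Lie algebra $\mathfrak{g}$ over $k$, $\mu(\mathfrak{g})=\min\{\dim_k V : (\pi,V) \text{ is a faithful representation of } \mathfrak{g}\}$, where a representation is a Lie algebra homomorphism $\pi:\mathfrak{g}\to\mathfrak{gl}(V)$ with $V$ a finite dimensional $k$-vector space, and it is faithful if $\pi$ is injective. The Heisenberg Lie algebra $\mathfrak{h}_m$ is the $k$-vector space of dimension $2m+1$ with basis $\{X_1,\dots,X_m,Y_1,\dots,Y_m,Z\}$ whose only non-zero brackets of basis elements (up to antisymmetry) are $[X_i,Y_i]=Z$, $i=1,\dots,m$. For a non-zero polynomial $p\in k[t]$, $(p)$ denotes the principal ideal of $k[t]$ generated by $p$, and $\mathfrak{h}_{m,p}=\mathfrak{h}_m\otimes_k k[t]/(p)$ is the Lie algebra over $k$ with bracket $[U_1\otimes q_1,U_2\otimes q_2]=[U_1,U_2]\otimes q_1q_2$ for $U_i\in\mathfrak{h}_m$, $q_i\in k[t]/(p)$. The symbol $\lceil a\rceil$ denotes the smallest integer greater than or equal to $a$. *)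

(* Defs.v *)
From HB Require Import structures.
From mathcomp Require Import all_boot all_order all_algebra.
From mathcomp Require Import reals.

Set Implicit Arguments.
Unset Strict Implicit.
Unset Printing Implicit Defensive.

Import Order.TTheory GRing.Theory Num.Theory.
Local Open Scope ring_scope.

HB.mixin Record Lmodule_isLieAlgebra (k : fieldType) L of GRing.Lmodule k L := {
  lie : L -> L -> L;
  lieDl : forall x y z, lie (x + y) z = lie x z + lie y z;
  lieDr : forall x y z, lie x (y + z) = lie x y + lie x z;
  lieZl : forall a x y, lie (a *: x) y = a *: lie x y;
  lieZr : forall a x y, lie x (a *: y) = a *: lie x y;
  liexx : forall x, lie x x = 0;
  lie_jacobi : forall x y z,
    lie x (lie y z) + lie y (lie z x) + lie z (lie x y) = 0
}.

#[short(type="lieAlgType")]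
HB.structure Definition LieAlgebra (k : fieldType) :=
  {L of GRing.Lmodule k L & Lmodule_isLieAlgebra k L}.

#[short(type="lieVectType")]
HB.structure Definition LieVector (k : fieldType) :=
  {L of Vector k L & LieAlgebra k L}.

Fact jacobi_cancel (V : zmodType) (a b c d e f : V) :
  a - b - (c - d) + (c - e - (f - b)) + (f - d - (a - e)) = 0.
Proof.
rewrite !opprB !addrA !subrK (ACl (1*8*2*5*3*6*4*7))%AC /=.
by rewrite subrK addrK subrK subrr.
Qed.

Section GeneralLinear.
Variables (k : fieldType) (V : vectType k).

Definition gl : Type := 'End(V).
HB.instance Definition _ := Vector.on gl.

Definition gl_lie (f g : gl) : gl := (f \o g)%VF - (g \o f)%VF.

Let gl_lieDl f g h : gl_lie (f + g) h = gl_lie f h + gl_lie g h.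
Proof. by rewrite /gl_lie comp_lfunDl comp_lfunDr opprD addrACA. Qed.
Let gl_lieDr f g h : gl_lie f (g + h) = gl_lie f g + gl_lie f h.
Proof. by rewrite /gl_lie comp_lfunDl comp_lfunDr opprD addrACA. Qed.
Let gl_lieZl a f g : gl_lie (a *: f) g = a *: gl_lie f g.
Proof. by rewrite /gl_lie -comp_lfunZl -comp_lfunZr scalerBr. Qed.
Let gl_lieZr a f g : gl_lie f (a *: g) = a *: gl_lie f g.
Proof. by rewrite /gl_lie -comp_lfunZl -comp_lfunZr scalerBr. Qed.
Let gl_liexx f : gl_lie f f = 0.
Proof. by rewrite /gl_lie subrr. Qed.
Let gl_lie_jacobi f g h :
  gl_lie f (gl_lie g h) + gl_lie g (gl_lie h f) + gl_lie h (gl_lie f g) = 0.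
Proof.
rewrite /gl_lie !(comp_lfunDl, comp_lfunDr, comp_lfunNl, comp_lfunNr).
rewrite !comp_lfunA; exact: jacobi_cancel.
Qed.

HB.instance Definition _ := Lmodule_isLieAlgebra.Build k gl
  gl_lieDl gl_lieDr gl_lieZl gl_lieZr gl_liexx gl_lie_jacobi.
End GeneralLinear.

Section FaithfulRepresentations.
Variable k : fieldType.

Definition has_faithful_rep (g : lieAlgType k) (n : nat) : Prop :=
  exists (V : vectType k) (rho : {linear g -> gl V}),
    [/\ {morph rho : x y / lie x y >-> lie x y}, injective rho
      & \dim {:V} = n].

(* n = mu(g): the minimum exists and equals n. *)
Definition is_mu (g : lieAlgType k) (n : nat) : Prop :=
  has_faithful_rep g n /\ forall n', has_faithful_rep g n' -> (n <= n')%N.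

End FaithfulRepresentations.

Section Heisenberg.
Variables (k : fieldType) (m : nat).

(* (a, b, c) stands for \sum_i a_i X_i + \sum_i b_i Y_i + c Z. *)
Definition heis : Type := ('rV[k]_m * 'rV[k]_m * k^o)%type.
HB.instance Definition _ := Vector.on heis.

Definition heisX (i : 'I_m) : heis := (delta_mx 0 i, 0, 0).
Definition heisY (i : 'I_m) : heis := (0, delta_mx 0 i, 0).
Definition heisZ : heis := (0, 0, 1).

Definition heis_lie (u v : heis) : heis :=
  (0, 0, \sum_i (u.1.1 0 i * v.1.2 0 i - v.1.1 0 i * u.1.2 0 i)).

Let heis_lieDl u v w : heis_lie (u + v) w = heis_lie u w + heis_lie v w.
Proof.
rewrite /heis_lie; congr (_, _, _); rewrite /= ?addr0 // -big_split /=.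
by apply: eq_bigr => i _; rewrite !mxE mulrDl mulrDr opprD addrACA.
Qed.
Let heis_lieDr u v w : heis_lie u (v + w) = heis_lie u v + heis_lie u w.
Proof.
rewrite /heis_lie; congr (_, _, _); rewrite /= ?addr0 // -big_split /=.
by apply: eq_bigr => i _; rewrite !mxE mulrDl mulrDr opprD addrACA.
Qed.
Let heis_lieZl a u v : heis_lie (a *: u) v = a *: heis_lie u v.
Proof.
rewrite /heis_lie; congr (_, _, _); rewrite /= ?scaler0 // scaler_sumr.
by apply: eq_bigr => i _; rewrite !mxE scalerBr /GRing.scale /=
  !mulrA (mulrC a (v.1.1 0 i)).
Qed.
Let heis_lieZr a u v : heis_lie u (a *: v) = a *: heis_lie u v.
Proof.
rewrite /heis_lie; congr (_, _, _); rewrite /= ?scaler0 // scaler_sumr.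
by apply: eq_bigr => i _; rewrite !mxE scalerBr /GRing.scale /=
  !mulrA (mulrC a (u.1.1 0 i)).
Qed.
Let heis_liexx u : heis_lie u u = 0.
Proof.
rewrite /heis_lie; congr (_, _, _); rewrite /= big1 // => i _.
by rewrite subrr.
Qed.
Let heis_lie0 u v w : heis_lie u (heis_lie v w) = 0.
Proof.
rewrite /heis_lie; congr (_, _, _); rewrite /= big1 // => i _.
by rewrite !mxE mulr0 mul0r subrr.
Qed.
Let heis_lie_jacobi u v w : heis_lie u (heis_lie v w) +
  heis_lie v (heis_lie w u) + heis_lie w (heis_lie u v) = 0.
Proof. by rewrite !heis_lie0 !addr0. Qed.

HB.instance Definition _ := Lmodule_isLieAlgebra.Build k heis
  heis_lieDl heis_lieDr heis_lieZl heis_lieZr heis_liexx heis_lie_jacobi.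

Lemma heis_lieE u v : lie u v = (0, 0,
  \sum_i (u.1.1 0 i * v.1.2 0 i - v.1.1 0 i * u.1.2 0 i)) :> heis.
Proof. by []. Qed.

Lemma dim_heis : dim heis = (2 * m).+1.
Proof. by rewrite /dim /= -[RHS]addn1 mul2n -addnn -[in RHS](mul1n m). Qed.

Lemma heis_decomp (u : heis) :
  u = \sum_i u.1.1 0 i *: heisX i + \sum_i u.1.2 0 i *: heisY i + u.2 *: heisZ.
Proof.
have row_decomp (r : 'rV[k]_m) : r = \sum_i r 0 i *: delta_mx 0 i.
  by rewrite {1}[r]matrix_sum_delta big_ord1.
have E (v w : heis) : v.1.1 = w.1.1 -> v.1.2 = w.1.2 -> v.2 = w.2 -> v = w.
  by case: v w => [[a b] c] [[a' b'] c'] /= -> -> ->.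
have S1 (F : 'I_m -> heis) : (\sum_i F i).1.1 = \sum_i (F i).1.1.
  by apply: (big_morph (fun v : heis => v.1.1)).
have S2 (F : 'I_m -> heis) : (\sum_i F i).1.2 = \sum_i (F i).1.2.
  by apply: (big_morph (fun v : heis => v.1.2)).
have S3 (F : 'I_m -> heis) : (\sum_i F i).2 = \sum_i (F i).2.
  by apply: (big_morph (fun v : heis => v.2)).
apply: E.
- rewrite -[RHS]/((\sum_i u.1.1 0 i *: heisX i).1.1 +
    (\sum_i u.1.2 0 i *: heisY i).1.1 + u.2 *: (0 : 'rV_m)).
  by rewrite !S1 [X in _ + X + _]big1 ?scaler0 ?addr0 // => i _;
    rewrite /= scaler0.
- rewrite -[RHS]/((\sum_i u.1.1 0 i *: heisX i).1.2 +
    (\sum_i u.1.2 0 i *: heisY i).1.2 + u.2 *: (0 : 'rV_m)).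
  by rewrite !S2 [X in X + _ + _]big1 ?scaler0 ?addr0 ?add0r // => i _;
    rewrite /= scaler0.
- rewrite -[RHS]/((\sum_i u.1.1 0 i *: heisX i).2 +
    (\sum_i u.1.2 0 i *: heisY i).2 + u.2 *: (1 : k^o)).
  rewrite !S3 !big1 ?add0r => [|i _|i _]; rewrite /= ?scaler0 //.
  by rewrite /GRing.scale /= mulr1.
Qed.

Lemma heis_lieXX i j : lie (heisX i) (heisX j) = 0.
Proof.
rewrite heis_lieE; congr (_, _, _); rewrite /= big1 // => l _.
by rewrite !mxE !(mulr0, mul0r) subrr.
Qed.

Lemma heis_lieYY i j : lie (heisY i) (heisY j) = 0.
Proof.
rewrite heis_lieE; congr (_, _, _); rewrite /= big1 // => l _.
by rewrite !mxE !(mulr0, mul0r) subrr.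
Qed.

Lemma heis_lieXY i j : lie (heisX i) (heisY j) = (i == j)%:R *: heisZ.
Proof.
rewrite heis_lieE; congr (_, _, _); rewrite /= ?scaler0 //.
rewrite (bigD1 i) //= big1 => [|l /negPf l_i]; rewrite !mxE ?eqxx.
  by rewrite mul1r mul0r subr0 addr0 [RHS]mulr1.
by rewrite l_i !mul0r subr0.
Qed.

Lemma heis_lieZ u : lie heisZ u = 0.
Proof.
rewrite heis_lieE; congr (_, _, _); rewrite /= big1 // => l _.
by rewrite !mxE !(mulr0, mul0r) subrr.
Qed.

End Heisenberg.

(* Finite-dimensional commutative associative unital algebras, zero algebra
   included: the algebra structures of ssralg require 1 != 0, which fails
   in k[t]/(p) for constant p. *)
HB.mixin Record Vector_isComAlgebra (k : fieldType) A of Vector k A := {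
  cmul : A -> A -> A;
  cone : A;
  cmulA : forall x y z, cmul x (cmul y z) = cmul (cmul x y) z;
  cmulC : forall x y, cmul x y = cmul y x;
  cmul1l : forall x, cmul cone x = x;
  cmulDl : forall x y z, cmul (x + y) z = cmul x z + cmul y z;
  cmulZl : forall a x y, cmul (a *: x) y = a *: cmul x y
}.

#[short(type="comVectAlgType")]
HB.structure Definition ComVectAlgebra (k : fieldType) :=
  {A of Vector k A & Vector_isComAlgebra k A}.

Section PolyQuotient.
Variables (k : fieldType) (p : {poly k}).

(* k[t]/(p), as remainders modulo p (the zero algebra, by convention,
   when p = 0); see pquot_pi_eq and pquot_pi_surj. *)
Definition pquot : Type := {poly_(size p).-1 k}.
HB.instance Definition _ := Vector.on pquot.

Definition pquot_pi (q : {poly k}) : pquot := npolyp (size p).-1 (q %% p).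

Definition pquot_mul (x y : pquot) : pquot := pquot_pi (polyn x * polyn y).

Lemma pquot_piE (q : {poly k}) : p != 0 -> polyn (pquot_pi q) = q %% p.
Proof.
move=> p_neq0; rewrite /pquot_pi npolypK //.
by rewrite -ltnS prednK ?ltn_modp // lt0n size_poly_eq0.
Qed.

Let pquot0 (x y : pquot) : p = 0 -> x = y.
Proof.
move=> p0; apply/val_inj; move: x y; rewrite /pquot p0 size_poly0 => x y.
have vE (z : {poly_0 k}) : polyn z = 0.
  by apply/eqP; rewrite -size_poly_eq0 -leqn0 size_npoly.
by rewrite /= !vE.
Qed.

Lemma pquot_piK (x : pquot) : pquot_pi (polyn x) = x.
Proof.
have [p0|p_neq0] := eqVneq p 0; first exact: pquot0.
apply/val_inj; rewrite /= pquot_piE // modp_small //.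
by rewrite (leq_ltn_trans (size_npoly x)) // ltn_predL lt0n size_poly_eq0.
Qed.

Lemma pquot_pi_surj (x : pquot) : exists q, pquot_pi q = x.
Proof. by exists (polyn x); rewrite pquot_piK. Qed.

Lemma pquot_pi_eq (q r : {poly k}) : p != 0 ->
  pquot_pi q = pquot_pi r <-> p %| q - r.
Proof.
move=> p_neq0; rewrite /dvdp modpD modpN; split=> [qr |].
  by apply/eqP; rewrite -!pquot_piE // qr subrr.
by rewrite subr_eq0 => /eqP qr; apply/val_inj; rewrite /= !pquot_piE.
Qed.

Let pquot_pi_linear : linear pquot_pi.
Proof.
move=> a q r; have [p0|p_neq0] := eqVneq p 0; first exact: pquot0.
by apply/val_inj; rewrite /= !pquot_piE // modpD modpZl.
Qed.
HB.instance Definition _ := GRing.isSemilinear.Build k {poly k} pquot _ pquot_pi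
  (GRing.semilinear_linear pquot_pi_linear).

Lemma pquot_piM (q r : {poly k}) :
  pquot_pi (q * r) = pquot_mul (pquot_pi q) (pquot_pi r).
Proof.
have [p0|p_neq0] := eqVneq p 0; first exact: pquot0.
by apply/val_inj; rewrite /= /pquot_mul !pquot_piE // modp_mul
  [in RHS]mulrC modp_mul mulrC.
Qed.

Let pquot_mulA x y z :
  pquot_mul x (pquot_mul y z) = pquot_mul (pquot_mul x y) z.
Proof.
by rewrite -[x]pquot_piK -[y]pquot_piK -[z]pquot_piK -!pquot_piM mulrA.
Qed.
Let pquot_mulC x y : pquot_mul x y = pquot_mul y x.
Proof. by rewrite /pquot_mul mulrC. Qed.
Let pquot_mul1l x : pquot_mul (pquot_pi 1) x = x.
Proof. by rewrite -[x]pquot_piK -pquot_piM mul1r. Qed.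
Let pquot_mulDl x y z :
  pquot_mul (x + y) z = pquot_mul x z + pquot_mul y z.
Proof. by rewrite /pquot_mul mulrDl linearD. Qed.
Let pquot_mulZl a x y : pquot_mul (a *: x) y = a *: pquot_mul x y.
Proof. by rewrite /pquot_mul -scalerAl linearZ. Qed.

HB.instance Definition _ := Vector_isComAlgebra.Build k pquot
  pquot_mulA pquot_mulC pquot_mul1l pquot_mulDl pquot_mulZl.

End PolyQuotient.

Section Tensor.
Variables (k : fieldType) (U V : vectType k).

(* The tensor product, in coordinates with respect to the bases vbasis {:U}
   and vbasis {:V}; it has the universal property tlift_tens, tlift_unique. *)
Definition tensor : Type := 'M[k]_(\dim {:U}, \dim {:V}).
HB.instance Definition _ := Vector.on tensor.

Definition tens (u : U) (v : V) : tensor :=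
  \matrix_(i, j) (coord (vbasis {:U}) i u * coord (vbasis {:V}) j v).

Lemma tensDl u u' v : tens (u + u') v = tens u v + tens u' v.
Proof. by apply/matrixP => i j; rewrite !mxE linearD mulrDl. Qed.
Lemma tensDr u v v' : tens u (v + v') = tens u v + tens u v'.
Proof. by apply/matrixP => i j; rewrite !mxE linearD mulrDr. Qed.
Lemma tensZl a u v : tens (a *: u) v = a *: tens u v.
Proof. by apply/matrixP => i j; rewrite !mxE linearZ /= mulrA. Qed.
Lemma tensZr a u v : tens u (a *: v) = a *: tens u v.
Proof. by apply/matrixP => i j; rewrite !mxE linearZ /= mulrCA. Qed.

Let bU (i : 'I_(\dim {:U})) : U := (vbasis {:U})`_i.
Let bV (j : 'I_(\dim {:V})) : V := (vbasis {:V})`_j.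

Let tensE (x : tensor) : x = \sum_i \sum_j x i j *: tens (bU i) (bV j).
Proof.
rewrite {1}[x]matrix_sum_delta; apply: eq_bigr => i _; apply: eq_bigr => j _.
congr (_ *: _); apply/matrixP => i' j'.
have [fU fV] := (basis_free (vbasisP {:U}), basis_free (vbasisP {:V})).
by rewrite !mxE !coord_free // -natrM mulnb ![_ == i']eq_sym ![_ == j']eq_sym.
Qed.

Lemma tens_ind (P : tensor -> Prop) :
    (forall u v, P (tens u v)) -> (forall x y, P x -> P y -> P (x + y)) ->
  forall x, P x.
Proof.
move=> Pt PD x; have P0 : P 0.
  by have := Pt 0 0; rewrite -(scale0r (0 : U)) tensZl scale0r.
rewrite [x]tensE; apply: (big_ind P) => // i _; apply: (big_ind P) => // j _.
by rewrite -tensZl.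
Qed.

Section Lift.
Variables (W : lmodType k) (f : U -> V -> W).

Definition tlift (x : tensor) : W := \sum_i \sum_j x i j *: f (bU i) (bV j).

Let tlift_linear : linear tlift.
Proof.
move=> a x y; rewrite /tlift scaler_sumr -big_split; apply: eq_bigr => i _.
rewrite scaler_sumr -big_split; apply: eq_bigr => j _ /=.
by rewrite !mxE scalerDl scalerA.
Qed.
HB.instance Definition _ := GRing.isSemilinear.Build k tensor W _ tlift
  (GRing.semilinear_linear tlift_linear).

Hypotheses (fl : forall v, linear (f^~ v)) (fr : forall u, linear (f u)).

Lemma tlift_tens u v : tlift (tens u v) = f u v.
Proof.
pose Lf v : {linear U -> W} :=
  HB.pack (f^~ v) (GRing.isLinear.Build k U W _ (f^~ v) (fl v)).
pose Rf u : {linear V -> W} :=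
  HB.pack (f u) (GRing.isLinear.Build k V W _ (f u) (fr u)).
have uE : u = \sum_i coord (vbasis {:U}) i u *: bU i.
  exact/coord_vbasis/memvf.
have vE : v = \sum_j coord (vbasis {:V}) j v *: bV j.
  exact/coord_vbasis/memvf.
rewrite /tlift [in RHS]uE -[RHS]/(Lf v _) linear_sum; apply: eq_bigr => i _.
rewrite linearZ /= [in RHS]vE -[f _ _]/(Rf _ _) linear_sum scaler_sumr.
apply: eq_bigr => j _; rewrite linearZ /= scalerA; congr (_ *: _).
by rewrite mxE.
Qed.

End Lift.

Lemma tlift_unique (W : lmodType k) (g h : {linear tensor -> W}) :
  (forall u v, g (tens u v) = h (tens u v)) -> g =1 h.
Proof. by move=> gh; elim/tens_ind=> // x y; rewrite !linearD => -> ->. Qed.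

End Tensor.

Section CurrentAlgebra.
Variables (k : fieldType) (g : lieVectType k) (A : comVectAlgType k).

(* g \otimes A with [x \otimes a, y \otimes b] = [x, y] \otimes ab;
   see current_lie_tens. *)
Definition current : Type := tensor g A.
HB.instance Definition _ := Vector.on current.

Definition current_lie (s t : current) : current :=
  tlift (fun x a => tlift (fun y b => tens (lie x y) (cmul a b) : current) t) s.

Let cmulDr (a b c : A) : cmul a (b + c) = cmul a b + cmul a c.
Proof. by rewrite !(cmulC a) cmulDl. Qed.
Let cmulZr c (a b : A) : cmul a (c *: b) = c *: cmul a b.
Proof. by rewrite !(cmulC a) cmulZl. Qed.

Let inner (x : g) (a : A) (t : current) : current :=
  tlift (fun y b => tens (lie x y) (cmul a b) : current) t.
Let innerE x a y b : inner x a (tens y b) = tens (lie x y) (cmul a b).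
Proof.
rewrite /inner tlift_tens // => z c s s'.
  by rewrite lieDr lieZr tensDl tensZl.
by rewrite cmulDr cmulZr tensDr tensZr.
Qed.
Let inner_linear_l a t : linear (fun x => inner x a t).
Proof.
move=> c x x'; elim/tens_ind: t => [y b | t t' IHt IHt'].
  by rewrite !innerE lieDl lieZl tensDl tensZl.
have innerD z : inner z a (t + t') = inner z a t + inner z a t'.
  exact: linearD.
by rewrite !innerD IHt IHt' scalerDr addrACA.
Qed.
Let inner_linear_r x t : linear (fun a => inner x a t).
Proof.
move=> c a a'; elim/tens_ind: t => [y b | t t' IHt IHt'].
  by rewrite !innerE cmulDl cmulZl tensDr tensZr.
have innerD d : inner x d (t + t') = inner x d t + inner x d t'.
  exact: linearD.
by rewrite !innerD IHt IHt' scalerDr addrACA.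
Qed.
Let current_lieE x a t : current_lie (tens x a) t = inner x a t.
Proof.
apply: (tlift_tens (f := fun x a => inner x a t)) => [b|y].
  exact: inner_linear_l.
exact: inner_linear_r.
Qed.

Let current_tens x a y b :
  current_lie (tens x a) (tens y b) = tens (lie x y) (cmul a b).
Proof. by rewrite current_lieE innerE. Qed.

Let current_lieDl r s t :
  current_lie (r + s) t = current_lie r t + current_lie s t.
Proof. exact: linearD. Qed.
Let current_lieZl c s t : current_lie (c *: s) t = c *: current_lie s t.
Proof. exact: linearZ. Qed.
Let current_lieDr r s t :
  current_lie r (s + t) = current_lie r s + current_lie r t.
Proof.
elim/tens_ind: r => [x a | r r' IHr IHr'].
  by rewrite !current_lieE /inner linearD.
by rewrite !current_lieDl IHr IHr' addrACA.
Qed.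
Let current_lieZr c s t : current_lie s (c *: t) = c *: current_lie s t.
Proof.
elim/tens_ind: s => [x a | s s' IHs IHs'].
  by rewrite !current_lieE /inner linearZ.
by rewrite !current_lieDl IHs IHs' scalerDr.
Qed.

Let lie_anti (x y : g) : lie x y + lie y x = 0.
Proof.
by have := liexx (x + y); rewrite lieDl !lieDr !liexx add0r addr0.
Qed.

Let current_anti s t : current_lie s t + current_lie t s = 0.
Proof.
elim/tens_ind: s => [x a | s s' IHs IHs'].
  elim/tens_ind: t => [y b | t t' IHt IHt'].
    by rewrite !current_tens (cmulC b a) -tensDl lie_anti
      -(scale0r 0) tensZl scale0r.
  by rewrite current_lieDr current_lieDl addrACA IHt IHt' addr0.
by rewrite current_lieDr current_lieDl addrACA IHs IHs' addr0.
Qed.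
Let current_liexx s : current_lie s s = 0.
Proof.
elim/tens_ind: s => [x a | s t IHs IHt].
  by rewrite current_tens liexx -(scale0r 0) tensZl scale0r.
by rewrite current_lieDl !current_lieDr IHs IHt add0r addr0 current_anti.
Qed.
Let current_jacobi r s t : current_lie r (current_lie s t) +
  current_lie s (current_lie t r) + current_lie t (current_lie r s) = 0.
Proof.
pose J r s t := current_lie r (current_lie s t) +
  current_lie s (current_lie t r) + current_lie t (current_lie r s).
have JD r' r1 s' t' : J (r' + r1) s' t' = J r' s' t' + J r1 s' t'.
  by rewrite /J !(current_lieDl, current_lieDr) (AC (2*2*2) (1*3*5*(2*4*6)))%AC.
have JC r' s' t' : J r' s' t' = J s' t' r'.
  by rewrite /J -addrA addrC.
rewrite -/(J r s t).
elim/tens_ind: r => [x a | r r' IHr IHr']; last by rewrite JD IHr IHr' addr0.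
rewrite JC; elim/tens_ind: s => [y b | s s' IHs IHs']; last first.
  by rewrite JD IHs IHs' addr0.
rewrite JC; elim/tens_ind: t => [z c | t t' IHt IHt']; last first.
  by rewrite JD IHt IHt' addr0.
rewrite /J !current_tens.
have -> : cmul b (cmul c a) = cmul a (cmul b c) by rewrite cmulA [RHS]cmulC.
have -> : cmul c (cmul a b) = cmul a (cmul b c) by rewrite cmulC cmulA.
rewrite -!tensDl.
by rewrite lie_jacobi -(scale0r 0) tensZl scale0r.
Qed.

HB.instance Definition _ := Lmodule_isLieAlgebra.Build k current
  current_lieDl current_lieDr current_lieZl current_lieZr
  current_liexx current_jacobi.

Lemma current_lie_tens x a y b :
  lie (tens x a : current) (tens y b) = tens (lie x y) (cmul a b).
Proof. exact: current_tens. Qed.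

End CurrentAlgebra.

Definition heisp (k : fieldType) (m : nat) (p : {poly k}) : lieAlgType k :=
  current (heis k m) (pquot p).

(* Main.v *)
Require Import Defs.
From HB Require Import structures.
From mathcomp Require Import all_boot all_order all_algebra separable.
From mathcomp Require Import boolp reals ring zify.

Import Order.TTheory GRing.Theory Num.Theory.
Import VectorInternalTheory.
Local Open Scope ring_scope.

(** Write [A = k[t]/(p)], [d = deg p] and [Z] for the centre of the current
    algebra, a copy of [A].

    Upper bound ([heisp_upper_bound]).  If [a * b >= d], the algebra acts
    faithfully by strictly block triangular operators on [k^a + A^m + k^b]:
    [Y_i q] sends [k^b] to the [i]-th copy of [A] through the elements
    [q t^(a j)], [X_i q] sends this copy to [k^a] through the functionals
    [x |-> lambda (q t^i x)], where [lambda] is the coefficient of [t^(d-1)],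
    and [Z q] is the product of the two.  The halves of
    [c = ceil (2 sqrt d)] have a product [>= d] and a sum equal to [c].

    Lower bound ([rep_dim_bound]).  Since the central elements are brackets,
    they act nilpotently, and a faithful representation can be modified,
    without changing its dimension or the action of [Z], so that a basis of
    the algebra acts by nilpotent operators: subtract the semisimple parts
    ([nilpotent_twist]).  Let [v] be a vector such that some functional of the
    form [z |-> phi (z v)] on [Z = A] vanishes on no nonzero ideal of [A], as
    holds outside a finite union of proper subspaces; among these vectors, let
    [r = dim Z v] be maximal.  The stabiliser of [v] is isotropic for the
    alternating form [phi ([x, y] v)], whose radical is [Z]; comparing
    dimensions, [dim g v >= m d + r].  Let [s] be the codimension of [g v].
    By nilpotency, [s] vectors that span a complement of [g v] generate the
    representation ([nilrep_generators]), so an element of [Z] that kills them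
    all is zero; taking them outside the same proper subspaces, [d <= r s] by
    the choice of [r].  The dimension is therefore at least [m d + r + s] with
    [r s >= d], and [(r + s)^2 >= 4 d] by the inequality of arithmetic and
    geometric means. *)

(** * Polynomials in characteristic zero *)

Section PolyLemmas.
Variable k : fieldType.
Implicit Types p q f h : {poly k}.

Lemma comp_poly_taylor q f h : exists c,
  q \Po (f + h) = q \Po f + (q^`() \Po f) * h + c * h ^+ 2.
Proof.
elim/poly_ind: q => [|q a [c IHq]].
  by exists 0; rewrite deriv0 !comp_poly0 !mul0r !addr0.
exists (c * (f + h) + (q^`() \Po f)).
rewrite derivD derivM derivX derivC addr0 mulr1.
rewrite !(comp_polyD, comp_polyM, comp_polyC, comp_polyX) IHq.
ring.
Qed.

Lemma deriv_eq0_size p : [pchar k] =i pred0 -> p^`() = 0 -> (size p <= 1)%N.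
Proof.
move=> char0 p'0; apply/leq_sizeP => -[//|i] _.
have /eqP := congr1 (fun r : {poly k} => r`_i) p'0.
rewrite coef_deriv coef0 -mulr_natr mulf_eq0 => /orP[/eqP //|].
by have/pcharf0P-> := char0.
Qed.

(** If every nonconstant divisor of [p] meets [q], split off [gcdp p q] and
    recurse on the quotient. *)
Lemma dvdp_exp_of_radical p q :
    p != 0 -> (forall r, r %| p -> coprimep r q -> (size r <= 1)%N) ->
  exists n, p %| q ^+ n.
Proof.
have [n] := ubnP (size p); elim: n p => // n IHn p; rewrite ltnS => le_p p0 rad.
have [cpq|] := boolP (coprimep p q).
  exists 0; rewrite expr0 dvdp1 eqn_leq rad //= lt0n size_poly_eq0 //.
rewrite coprimep_def => ncpq; set e := gcdp p q in ncpq.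
have De : e * (p %/ e) = p by rewrite mulrC divpK ?dvdp_gcdl.
have [e0 p10] : e != 0 /\ p %/ e != 0.
  by apply/andP; rewrite -negb_or -mulf_eq0 De.
have [||r r_p1|i p1_qi] := IHn (p %/ e); rewrite //.
- rewrite size_divp //; apply: leq_trans le_p.
  have : (0 < size e)%N by rewrite lt0n size_poly_eq0.
  have : (size e <= size p)%N by rewrite dvdp_leq ?dvdp_gcdl.
  rewrite -/e; move: (size e) ncpq (size p) => [|[|?]] // _ [|?] //= _ _.
  by rewrite subSS ltnS leq_subr.
- by apply: rad; rewrite (dvdp_trans r_p1) // divp_dvd ?dvdp_gcdl.
by exists i.+1; rewrite -De exprS dvdp_mul ?dvdp_gcdr.
Qed.

(** The squarefree part [p / gcd(p, p')].  A divisor [h] of [g = gcd(p, p')]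
    that is coprime to it and maximal for this property divides its own
    derivative, hence is constant in characteristic zero; so the squarefree
    part meets every nonconstant divisor of [g]. *)
Lemma separable_radical p : [pchar k] =i pred0 -> p != 0 ->
  exists q, [/\ coprimep q q^`(), q %| p & exists n, p %| q ^+ n].
Proof.
move=> char0 p0; set g := gcdp p p^`(); exists (p %/ g).
have Dp : p %/ g * g = p by rewrite divpK ?dvdp_gcdl.
have g0 : g != 0 by rewrite gcdp_eq0 (negPf p0).
split; [by have := make_separable p0;
  rewrite unlock | exact/divp_dvd/dvdp_gcdl|].
set q := p %/ g in Dp *; have q0 : q != 0.
  by apply: contraNneq p0 => q0; rewrite -Dp q0 mul0r.
have rad_g r : r %| g -> coprimep r q -> (size r <= 1)%N.
  have [h h_g] := gdcopP q g; rewrite (negPf g0) orbF => co_hq max_h.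
  move=> r_g co_rq; have h0 : h != 0 by apply: contraNneq g0 => h0;
    rewrite h0 dvd0p in h_g.
  apply: leq_trans (dvdp_leq h0 (max_h r r_g co_rq)) _.
  have [w Dg] : exists w, g = w * h by apply/dvdpP.
  have w0 : w != 0 by apply: contraNneq g0 => w0; rewrite Dg w0 mul0r.
  have co_hw : coprimep h w.
    set d := gcdp h w; have: d * h %| h.
      apply: max_h; first by rewrite Dg dvdp_mul ?dvdp_gcdr.
      by rewrite coprimepMl co_hq (coprimep_dvdr (dvdp_gcdl h w)).
    by rewrite -{2}[h]mul1r dvdp_mul2r // dvdp1 coprimep_def.
  apply: deriv_eq0_size => //.
  have : h %| h^`().
    rewrite -(@Gauss_dvdpr _ _ q) // -(@Gauss_dvdpr _ _ w) //.
    have: g %| p^`() by apply: dvdp_gcdr.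
    rewrite -Dp derivM dvdp_addr ?dvdp_mulIr // Dg derivM mulrDr.
    move=> /(dvdp_trans (dvdp_mulIr w h));
      rewrite mulrA dvdp_addr ?dvdp_mulIr //.
    by rewrite mulrCA mulrA.
  have [//|h'0] := eqVneq h^`() 0.
  by move/(dvdp_leq h'0); rewrite leqNgt lt_size_deriv.
have [|n g_qn] := dvdp_exp_of_radical g q g0; first by [].
by exists n.+1; rewrite exprS -Dp dvdp_mul.
Qed.

(** Newton's iteration for a root of [q] modulo powers of [q], started at the
    variable: the step [f - q(f) v(f)], where [v] inverts [q'] modulo [q],
    doubles the exponent. *)
Lemma hensel_root q n : coprimep q q^`() ->
  exists f, q %| f - 'X /\ q ^+ n.+1 %| q \Po f.
Proof.
case/Bezout_eq1_coprimepP=> -[u v] /= uv; elim: n => [|n [f [q_f qn_f]]].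
  by exists 'X; rewrite subrr dvdp0 comp_polyXr expr1.
have q_qf : q %| q \Po f by apply: dvdp_trans qn_f; rewrite exprS dvdp_mulIl.
exists (f - (q \Po f) * (v \Po f)); split.
  by rewrite addrAC dvdp_addl // dvdpNr dvdp_mulr.
have [c ->] := comp_poly_taylor q f (- ((q \Po f) * (v \Po f))).
have -> : forall s t w : {poly k}, s + t * - (s * w) = s * (1 - w * t).
  by move=> s t w; rewrite mulrBr mulr1 mulrN mulrCA [t * w]mulrC.
have -> : 1 - (v \Po f) * (q^`() \Po f) = (u \Po f) * (q \Po f).
  rewrite -[1](comp_polyC 1 f) -[X in X \Po f]uv comp_polyD !comp_polyM.
  by rewrite addrK.
have q2 : q ^+ n.+2 %| (q \Po f) ^+ 2.
  by rewrite exprS expr2 dvdp_mul.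
rewrite sqrrN exprMn dvdp_add //; last by rewrite mulrCA dvdp_mulr.
by rewrite mulrCA -expr2 dvdp_mull.
Qed.

(** The Jordan-Chevalley decomposition at the level of polynomials: for [a]
    with characteristic polynomial [p], [f(a)] is the semisimple part of [a].
    That [p] divides [f'] comes from differentiating [q(f) = 0 mod q^N], as
    [q'(f)] is prime to [q]. *)
Lemma semisimple_part_poly p : [pchar k] =i pred0 -> p != 0 ->
  exists f n, p %| f^`() /\ p %| ('X - f) ^+ n.
Proof.
move=> char0 p0; have [q [co_q q_p [n p_qn]]] := separable_radical p char0 p0.
have [f [q_f qn_f]] := hensel_root q n co_q; exists f, n; split; last first.
  by rewrite (dvdp_trans p_qn) // dvdp_exp2r // -dvdpNr opprB.
apply: (dvdp_trans p_qn); rewrite -(@Gauss_dvdpr _ _ (q^`() \Po f)).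
  rewrite -deriv_comp; have /dvdpP[c ->] := qn_f.
  rewrite derivM dvdp_add ?dvdp_mull //; first by rewrite exprS dvdp_mull.
  by rewrite deriv_exp /= -mulr_natr -mulrA mulrCA dvdp_mulr.
apply: coprimep_expl; have [c] := comp_poly_taylor q^`() 'X (f - 'X).
rewrite addrC subrK comp_polyXr => ->; rewrite -addrA.
rewrite expr2 mulrA -mulrDl; move: (_ + c * _) => a.
by have /dvdpP[e ->] := q_f; rewrite mulrA addrC coprimep_addl_mul.
Qed.
End PolyLemmas.

(** * Nilpotent operators *)

Section Operators.
Variables (k : fieldType) (n : nat).
Implicit Types (a b c s : 'M[k]_n.+1) (f : {poly k}).

(** When [c = [a, b]] commutes with [a], the bracket with [b] acts on
    polynomials in [a] as [c d/da]. *)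
Lemma horner_mx_commutator a b f : let c := a * b - b * a in
  GRing.comm a c ->
  horner_mx a f * b - b * horner_mx a f = horner_mx a f^`() * c.
Proof.
move=> c co_ac; have abE : a * b = b * a + c by rewrite addrC subrK.
elim/poly_ind: f => [|f x IHf];
  first by rewrite deriv0 !rmorph0 mulr0 !mul0r subrr.
have fbE : horner_mx a f * b = b * horner_mx a f + horner_mx a f^`() * c.
  by rewrite -IHf addrC subrK.
have xbE : x%:M * b = b * x%:M := esym (scalar_mxC x b).
rewrite derivD derivM derivX derivC addr0 mulr1 !(rmorphD, rmorphM) /=.
rewrite horner_mx_X horner_mx_C !mulrDl mulrDr xbE opprD addrACA subrr addr0.
rewrite -mulrA abE mulrDr 2!mulrA fbE mulrDl -!mulrA -[c * a]co_ac.
by rewrite addrAC [_ + _ - _]addrAC subrr add0r.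
Qed.

(** Bracketing [p(a) = 0] repeatedly with [b] gives [p^(i)(a) c^i = 0]; for [i]
    the degree of the monic [p], the left factor is a nonzero scalar. *)
Lemma central_commutator_nilpotent a b : [pchar k] =i pred0 ->
  let c := a * b - b * a in
  GRing.comm a c -> GRing.comm b c -> exists i, c ^+ i = 0.
Proof.
move=> char0 c co_ac co_bc; pose p := char_poly a.
have IH i : horner_mx a p^`(i) * c ^+ i = 0.
  elim: i => [|i IHi]; first by rewrite Cayley_Hamilton mul0r.
  rewrite derivnS exprS mulrA -horner_mx_commutator // mulrBl.
  rewrite -!mulrA (commrX i co_bc) IHi mulr0 subr0 mulrA IHi.
  by rewrite mul0r.
exists n.+1; have := IH n.+1.
have -> : p^`(n.+1) = (n.+1)`!%:R%:P.
  have szp : size p = n.+2 by rewrite size_char_poly.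
  apply/polyP => i; rewrite coef_derivn coefC.
  case: i => [|i]; last by rewrite [p`_ _]nth_default ?mul0rn ?szp //
    addnS !ltnS leq_addr.
  rewrite addn0 ffactnn; have /monicP := char_poly_monic a.
  by rewrite lead_coefE -/p szp => ->.
rewrite horner_mx_C -scalemx1 -[_ *: _ * _]scalerAl mul1r => /eqP.
rewrite scaler_eq0 => /orP[|/eqP //].
by have/pcharf0P-> := char0; rewrite -leqn0 leqNgt fact_gt0.
Qed.

(** The semisimple part of [a] is central for everything that [a] almost
    commutes with: its bracket with [b] is [f'(a) [a, b]], and [f'(a) = 0].
    Subtracting semisimple parts plays the role of twisting by a weight on each
    generalised weight space. *)
Lemma semisimple_part a : [pchar k] =i pred0 ->
  exists f, (exists i, (a - horner_mx a f) ^+ i = 0) /\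
    forall b, GRing.comm a (a * b - b * a) -> GRing.comm (horner_mx a f) b.
Proof.
move=> char0; have p0 : char_poly a != 0 by apply/monic_neq0/char_poly_monic.
have vanish q : char_poly a %| q -> horner_mx a q = 0.
  by case/dvdpP=> r ->; rewrite rmorphM /= Cayley_Hamilton mulr0.
have [f [i [/vanish f'0 /vanish f_nil]]] := semisimple_part_poly k _ char0 p0.
exists f; split=> [|b co_b].
  by exists i; rewrite -{1}[a]horner_mx_X -rmorphB -rmorphXn.
apply/eqP; rewrite -subr_eq0 horner_mx_commutator //.
by rewrite f'0 mul0r.
Qed.

Lemma nilpotent_step (U M a : 'M[k]_n.+1) i : a ^+ i = 0 -> (U *m a <= U)%MS ->
  (M <= U + M *m a)%MS -> (M <= U)%MS.
Proof.
move=> ai0 Ua_U M_Ua; suff: (M <= U + M *m a ^+ i)%MS.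
  by rewrite ai0 mulmx0 addsmx0.
elim: (i) => [|j IHj]; first by rewrite expr0 mulmx1 addsmxSr.
apply: submx_trans M_Ua _; rewrite addsmx_sub addsmxSl /=.
apply: submx_trans (submxMr a IHj) _; rewrite addsmxMr exprSr mulmxA.
by rewrite addsmxS.
Qed.

(** A form of Engel's theorem for a finite list of nilpotent operators whose
    brackets land in the submodule [U] already reached: adding the images of
    the operators to [U] one at a time never fills up a module [M] that
    exceeds [U]. *)
Lemma nilpotent_nakayama (r : seq 'M[k]_n.+1) (U M : 'M[k]_n.+1) :
    {in r, forall a, exists i, a ^+ i = 0} ->
    {in r, forall a, (U *m a <= U)%MS} -> {in r, forall a, (M *m a <= M)%MS} ->
    {in r &, forall a b, (M *m (a * b - b * a) <= U)%MS} ->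
    (M <= U + \sum_(a <- r) M *m a)%MS -> (M <= U)%MS.
Proof.
elim: r U => [|a r IHr] U nil_r U_r M_r comm_r;
  first by rewrite big_nil addsmx0.
have rS b : b \in r -> b \in a :: r by rewrite in_cons orbC => ->.
have ra : a \in a :: r by rewrite in_cons eqxx.
rewrite big_cons addsmxA => M_sum; have [i ai0] := nil_r a ra.
apply: (nilpotent_step _ _ a i ai0 (U_r a ra));
  apply: IHr => [b br|b br|b br|b c br cr|].
- exact/nil_r/rS.
- rewrite addsmxMr addsmx_sub (submx_trans (U_r b _)) ?addsmxSl ?rS //=.
  have -> : M *m a *m b = M *m (a * b - b * a) + M *m b *m a.
    by rewrite mulmxBr !mulmxA subrK.
  rewrite addmx_sub //; first by apply: submx_trans (comm_r a b ra (rS b br))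
    (addsmxSl _ _).
  by rewrite (submx_trans _ (addsmxSr _ _)) // submxMr ?M_r ?rS.
- exact/M_r/rS.
- exact: submx_trans (comm_r b c (rS b br) (rS c cr)) (addsmxSl _ _).
- by [].
Qed.
End Operators.

(** * Generic vectors, dimensions and isotropic subspaces *)

Section VectorSpaces.
Variable k : fieldType.

(** A vector space over an infinite field is not a finite union of proper
    subspaces: given [v] outside all subspaces but the first and [w] outside
    the first, each subspace contains at most one of the [w + i v] when it
    does not contain [v]. *)
Lemma avoid_subspaces (vT : vectType k) (Us : seq {vspace vT}) :
    [pchar k] =i pred0 -> {in Us, forall U : {vspace vT}, U != fullv} ->
  exists v, {in Us, forall U : {vspace vT}, v \notin U}.
Proof.
move=> /pcharf0P char0; elim: Us => [|U Us IHU] properU; first by exists 0.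
have [V VUs|v v_Us] := IHU; first by apply: properU; rewrite in_cons VUs orbT.
have [vU|vNU] := boolP (v \in U); last first.
  by exists v => V; rewrite in_cons => /predU1P[->|/v_Us].
have /subvPn[w _ wNU] : ~~ (fullv <= U)%VS.
  by apply: contra (properU U (mem_head _ _)) => fU; rewrite eqEsubv subvf.
have [N HN] : exists N, forall i, (N <= i)%N ->
  {in Us, forall V : {vspace vT}, w + i%:R *: v \notin V}.
  elim: Us v_Us {IHU properU} => [|V Vs IHV] v_Vs; first by exists 0.
  have [|N HN] := IHV; first by move=> V' V'Vs; apply: v_Vs;
    rewrite in_cons V'Vs orbT.
  have [[i iV]|noV] := pselect (exists i, w + i%:R *: v \in V); last first.
    exists N => i le_i V'; rewrite in_cons => /predU1P[->|]; last exact: HN.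
    by apply/negP => iV; apply: noV; exists i.
  exists (maxn N i.+1) => j; rewrite geq_max => /andP[le_N lt_ij] V'.
  rewrite in_cons => /predU1P[{V'}->|]; last exact: HN.
  apply/negP => jV; have := memvB jV iV.
  rewrite opprD addrACA subrr add0r -scalerBl -natrB 1?ltnW //.
  have ji : (j - i)%:R != 0 :> k by rewrite char0 -lt0n subn_gt0.
  move/(memvZ (j - i)%:R^-1); rewrite scalerA mulVf // scale1r.
  by apply/negP/v_Vs; rewrite mem_head.
exists (w + N%:R *: v) => V; rewrite in_cons => /predU1P[->|]; last exact: HN.
by rewrite memvE -memvE rpredDr // rpredZ.
Qed.

Lemma complement_avoiding (vT : vectType k) (Us : seq {vspace vT})
  (W : {vspace vT}) :
    [pchar k] =i pred0 -> {in Us, forall U : {vspace vT}, U != fullv} ->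
  exists vs, [/\ {in vs, forall v, {in Us, forall U : {vspace vT}, v \notin U}},
    (W + <<vs>>)%VS = fullv & (size vs + \dim W = \dim {:vT})%N].
Proof.
move=> char0 properU; have [i] := ubnP (\dim {:vT} - \dim W).
elim: i W => // i IHi W; rewrite ltnS => le_i.
have [->|W_proper] := eqVneq W fullv.
  by exists [::]; rewrite sumfv.
have [U|v v_Us] := avoid_subspaces vT (W :: Us) char0.
  by rewrite in_cons => /predU1P[->|/properU].
have vW : v \notin W by apply: v_Us; rewrite mem_head.
have dimWv : \dim (W + <[v]>) = (\dim W).+1.
  rewrite dimv_disjoint_sum ?dim_vline; last first.
    apply/eqP; rewrite -subv0; apply/subvP => u /memv_capP[uW /vlineP[a Du]].
    rewrite memv0 Du; have [->|a0] := eqVneq a 0; first by rewrite scale0r.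
    case/negP: vW; rewrite -[v]scale1r -(mulVf a0) -scalerA -Du.
    exact: memvZ.
  by rewrite eq_sym (memPn vW 0 (mem0v W)) addn1.
have leWv : (\dim W < \dim {:vT})%N by rewrite -dimWv dimvS ?subvf.
have [|vs [vs_Us vs_full size_vs]] := IHi (W + <[v]>)%VS.
  by rewrite dimWv; apply: leq_trans le_i; rewrite ltn_sub2l.
exists (v :: vs); split; last by rewrite /= addSnnS -dimWv.
- move=> u; rewrite in_cons => /predU1P[->|/vs_Us//] U UUs.
  by apply: v_Us; rewrite in_cons UUs orbT.
- by rewrite span_cons addvA.
Qed.

Lemma dim_le_sum_img (aT rT : vectType k) (fs : seq 'Hom(aT, rT))
  (U : {vspace aT}) (r : nat) :
    {in fs, forall f, \dim (f @: U) <= r}%N ->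
    {in U, forall u, {in fs, forall f : 'Hom(aT, rT), f u = 0} -> u = 0} ->
  (\dim U <= size fs * r)%N.
Proof.
elim: fs U => [|f fs IHf] U le_r inj.
  rewrite leqn0 dimv_eq0 -subv0; apply/subvP => u uU.
  by rewrite memv0; apply/eqP/inj.
rewrite mulSn -(limg_ker_dim f U) addnC leq_add ?le_r ?mem_head // IHf //.
  move=> g gfs; apply: leq_trans (le_r g _); last by rewrite in_cons gfs orbT.
  by rewrite dimvS // limgS // capvSl.
move=> u /memv_capP[uU]; rewrite memv_ker => /eqP fu0 u0.
by apply: inj => // g; rewrite in_cons => /predU1P[->|/u0].
Qed.

(** With [G] the Gram matrix of [B] and [W] the matrix of the subspace,
    [W G W^T = 0] bounds the rank of [W G] by the codimension of the
    subspace, and the kernel of [G] lies in [Z]. *)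
Lemma isotropic_dim (vT : vectType k) (B : vT -> vT -> k) (W Z : {vspace vT}) :
    (forall y, scalar (B^~ y)) -> (forall x, scalar (B x)) ->
    {in W &, forall x y, B x y = 0} -> (forall x, (forall y, B x y = 0) ->
      x \in Z) ->
  (2 * \dim W <= \dim {:vT} + \dim Z)%N.
Proof.
move=> Bl Br B_W B_Z.
pose G := \matrix_(i, j) B (r2v (delta_mx 0 i)) (r2v (delta_mx 0 j))
  : 'M_(dim vT).
have BE x y : B x y = (v2r x *m G *m (v2r y)^T) 0 0.
  pose Bx : {linear vT -> k^o} := HB.pack (B x)
    (GRing.isLinear.Build k vT k^o _ (B x) (Br x)).
  pose By z : {linear vT -> k^o} := HB.pack (B^~ z)
    (GRing.isLinear.Build k vT k^o _ (B^~ z) (Bl z)).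
  have xE (z : vT) : z = \sum_i v2r z 0 i *: r2v (delta_mx 0 i).
    rewrite -[LHS]v2rK {1}[v2r z]matrix_sum_delta big_ord1 linear_sum.
    by apply: eq_bigr => i _; rewrite linearZ.
  rewrite [in LHS](xE y) -[LHS]/(Bx _) linear_sum !mxE; apply: eq_bigr => j _.
  rewrite linearZ /= [in LHS](xE x) -[B _ _]/(By (r2v (delta_mx 0 j)) _)
    linear_sum !mxE.
  rewrite -[LHS]mulrC; congr (_ * _); apply: eq_bigr => i _.
  by rewrite linearZ !mxE.
have WGW : vs2mx W *m G *m (vs2mx W)^T = 0.
  apply/matrixP => i j; rewrite [RHS]mxE.
  have mem_row l : r2v (row l (vs2mx W)) \in W by rewrite
    memvE /subsetv /= genmxE r2vK row_sub.
  rewrite -(B_W _ _ (mem_row i) (mem_row j)) BE !r2vK.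
  rewrite -row_mul tr_row [LHS]mxE [RHS]mxE; apply: eq_bigr => l _.
  by rewrite [row _ _ _ _]mxE [col _ _ _ _]mxE.
have rankG : (dim vT <= \rank G + \dim Z)%N.
  rewrite -leq_subLR -mxrank_ker /dimv; apply/mxrankS/row_subP => i.
  have := B_Z (r2v (row i (kermx G))).
  rewrite memvE /subsetv /= genmxE r2vK; apply=> y.
  by rewrite BE r2vK -row_mul mulmx_ker row0 mul0mx mxE.
have := mulmx0_rank_max WGW; have := mxrank_mul_min (vs2mx W) G.
rewrite mxrank_tr dimvf -/(dimv W); move: rankG;
  move: (\rank G) (\rank (_ *m _)).
by move=> a b; rewrite mul2n -addnn; lia.
Qed.
End VectorSpaces.

Lemma exists_max (T : Type) (P : T -> Prop) (f : T -> nat) b :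
    (exists x, P x) -> (forall x, P x -> f x <= b)%N ->
  exists2 x, P x & forall y, P y -> (f y <= f x)%N.
Proof.
move=> [x0 Px0] le_b; pose Q i := `[< exists2 x, P x & f x = i >].
have Q0 : exists i, Q i by exists (f x0); apply/asboolP; exists x0.
have Qb i : Q i -> (i <= b)%N by move=> /asboolP[x Px <-]; apply: le_b.
case: (ex_maxnP Q0 Qb) => i /asboolP[x Px <-] max_x; exists x => // y Py.
by apply: max_x; apply/asboolP; exists y.
Qed.

(** * Representations of two-step nilpotent Lie algebras *)

Section TwoStepNilpotent.
Variables (k : fieldType) (g : lieVectType k) (Z : {vspace g}) (n : nat).
Hypothesis char0 : [pchar k] =i pred0.
Hypothesis central : forall z x, z \in Z -> lie z x = 0.
Hypothesis derived : forall x y : g, lie x y \in Z.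
Hypothesis bracket : forall z, z \in Z -> exists x y : g, z = lie x y.

Definition is_rep (rho : g -> 'M[k]_n.+1) :=
  forall x y, rho (lie x y) = rho x * rho y - rho y * rho x.

Definition nil_mx (a : 'M[k]_n.+1) := exists i, a ^+ i = 0.

Lemma rep_central (rho : {linear g -> 'M[k]_n.+1}) z x : is_rep rho ->
  z \in Z ->
  GRing.comm (rho x) (rho z).
Proof.
move=> rep zZ; apply/esym/eqP.
by rewrite -subr_eq0 -rep central ?linear0.
Qed.

Lemma rep_central_nil (rho : {linear g -> 'M[k]_n.+1}) z : is_rep rho ->
  z \in Z -> nil_mx (rho z).
Proof.
move=> rep zZ; have [x [y Dz]] := bracket z zZ.
rewrite Dz rep; apply: central_commutator_nilpotent => //;
  by rewrite -rep -Dz; apply: rep_central.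
Qed.

Lemma semisimple_choice (rho : {linear g -> 'M[k]_n.+1}) : is_rep rho ->
  exists f : g -> {poly k}, forall x, nil_mx (rho x - horner_mx (rho x) (f x))
    /\
    forall y, GRing.comm (horner_mx (rho x) (f x)) (rho y).
Proof.
move=> rep; have: forall x, exists f, nil_mx (rho x - horner_mx (rho x) f) /\
    forall y, GRing.comm (horner_mx (rho x) f) (rho y).
  move=> x; have [f [nilf comf]] := semisimple_part _ _ (rho x) char0.
  by exists f; split=> // y; apply: comf; rewrite -rep; apply: rep_central.
by case/boolp.choice=> f Hf; exists f.
Qed.

(** Subtracting from [rho] a linear map [sigma] that takes each vector of a
    basis of a complement of [Z] to the semisimple part of its image, and
    kills [Z].  The values of [sigma] commute with each other and with those
    of [rho], so brackets do not change. *)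
Lemma nilpotent_twist (rho : {linear g -> 'M[k]_n.+1}) : is_rep rho ->
  exists (rho' : {linear g -> 'M[k]_n.+1}) (b : seq g),
    [/\ is_rep rho', {in Z, rho' =1 rho}, (Z + <<b>>)%VS = fullv
      & {in b, forall x, nil_mx (rho' x)}].
Proof.
move=> rep; have [f Hf] := semisimple_choice rho rep.
pose s x := horner_mx (rho x) (f x).
pose H := (Z^C)%VS; pose b := vbasis H.
have ZH0 : (Z :&: H = 0)%VS := capv_compl Z.
have HZ0 : (H :&: Z = 0)%VS by rewrite capvC.
pose sigma x := \sum_i coord b i (daddv_pi H Z x) *: s b`_i.
have sigma_lin : linear sigma.
  move=> a x y; rewrite /sigma scaler_sumr -big_split; apply: eq_bigr => i _ /=.
  by rewrite !linearP scalerDl scalerA.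
pose sigmaL : {linear g -> 'M[k]_n.+1} :=
  HB.pack sigma (GRing.isLinear.Build k g _ _ sigma sigma_lin).
have sigmaZ z : z \in Z -> sigma z = 0.
  move=> zZ; rewrite /sigma big1 // => i _.
  suff -> : daddv_pi H Z z = 0 by rewrite linear0 scale0r.
  have := daddv_pi_add HZ0 (subvP (addvSr H Z) z zZ).
  by rewrite (daddv_pi_id ZH0 zZ) => /(canRL (addrK z)); rewrite subrr.
have sigma_com x y : GRing.comm (sigma x) (rho y).
  apply/esym/commr_sum => i _; apply/commr_sym.
  rewrite /GRing.comm -scalerAl -scalerAr; congr (_ *: _).
  by have [_ ->] := Hf b`_i.
have sigma_comm x y : GRing.comm (sigma x) (sigma y).
  apply/commr_sum => i _; rewrite /GRing.comm -scalerAl -scalerAr;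
    congr (_ *: _).
  exact/comm_mx_horner/sigma_com.
exists (rho \- sigmaL), b; split.
- move=> x y /=; rewrite sigmaZ // subr0 rep.
  rewrite !mulrBl !mulrBr (sigma_com x y) (sigma_com y x) (sigma_comm y x).
  move: (rho x * sigma y) (rho y * sigma x) (sigma x * sigma y) => u v w.
  have shift a c d : a - c - (d - w) = a - (c + d - w) by rewrite
    -!addrA -!opprD !addrA.
  by rewrite !shift (addrC v u); move: (_ - w) => c; rewrite opprB addrA subrK.
- by move=> z zZ /=; rewrite sigmaZ // subr0.
- by rewrite (span_basis (vbasisP H)) addv_complf.
move=> x /(nthP 0)[i lt_i <-] /=.
have lt_i' : (i < \dim H)%N by rewrite size_tuple in lt_i.
suff -> : sigma b`_i = s b`_i by have [] := Hf b`_i.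
have bH : b`_i \in H by apply/vbasis_mem/mem_nth.
rewrite /sigma daddv_pi_id // (bigD1 (Ordinal lt_i')) //= big1 => [|j].
  by rewrite (coord_free (Ordinal lt_i')) ?(basis_free (vbasisP H)) //
    eqxx scale1r addr0.
rewrite -[i]/(val (Ordinal lt_i')) => ji.
by rewrite (coord_free _ j) ?(basis_free (vbasisP H)) // eq_sym (negPf ji)
  scale0r.
Qed.

(** Nakayama's lemma for nilpotent representations: vectors [vs] that span the
    space modulo [v g] generate it.  If the central [z] kills [vs], then the
    image [M] of [z] is [v g z = v z g], so [M = M g]; Engel's argument, first
    modulo [M Z] and then modulo [0], gives [M = 0]. *)
Lemma nilrep_generators (rho : {linear g -> 'M[k]_n.+1}) (b : seq g)
    (v : 'rV[k]_n.+1) (vs : seq 'rV[k]_n.+1) z :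
    is_rep rho -> (Z + <<b>>)%VS = fullv -> {in b, forall x, nil_mx (rho x)} ->
    (limg (linfun (mulmx v \o rho)) + <<vs>>)%VS = fullv ->
    z \in Z -> {in vs, forall w : 'rV_n.+1, w *m rho z = 0} -> 
  rho z = 0.
Proof.
move=> rep Zb nil_b gen zZ vs_z; pose M := rho z.
have com_M x : M *m rho x = rho x *m M := esym (rep_central rho z x rep zZ).
have M_stable x : (M *m rho x <= M)%MS by rewrite com_M submxMl.
pose MZ := (\sum_(x <- vbasis Z) M *m rho x)%MS.
have sumT (X : seq g) x : x \in <<X>>%VS -> (M *m rho x <= \sum_(y <- X)
  M *m rho y)%MS.
  elim: X x => [|y X IHX] x; first by rewrite span_nil memv0 => /eqP->;
    rewrite linear0 mulmx0 sub0mx.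
  rewrite span_cons big_cons => /memv_addP[u /vlineP[a ->] [w wX ->]].
  rewrite linearD mulmxDr linearZ -scalemxAr addmx_sub //.
    by rewrite (submx_trans _ (addsmxSl _ _)) ?scalemx_sub.
  by rewrite (submx_trans _ (addsmxSr _ _)) ?IHX.
have M_Z x : x \in Z -> (M *m rho x <= MZ)%MS.
  by move=> xZ; apply: sumT; rewrite (span_basis (vbasisP Z)).
have M_sum : (M <= MZ + \sum_(a <- map rho b) M *m a)%MS.
  rewrite big_map; apply/row_subP => i; rewrite rowE.
  have : (delta_mx 0 i : 'rV[k]_n.+1) \in fullv by apply: memvf.
  rewrite -gen => /memv_addP[_ /memv_imgP[x _ ->] [w w_vs ->]].
  rewrite mulmxDl lfunE /= -mulmxA -com_M.
  have -> : w *m M = 0.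
    have : (<<vs>> <= lker (linfun (mulmxr M)))%VS.
      by apply/span_subvP => u /vs_z u0; rewrite memv_ker lfunE /= u0.
    by move/subvP/(_ w w_vs); rewrite memv_ker lfunE => /eqP.
  rewrite addr0; apply: submx_trans (submxMl _ _) _.
  have : x \in (Z + <<b>>)%VS by rewrite Zb memvf.
  case/memv_addP=> y yZ [u ub ->]; rewrite linearD mulmxDr addmx_sub //.
    by rewrite (submx_trans (M_Z y yZ)) ?addsmxSl.
  by rewrite (submx_trans (sumT b u ub)) ?addsmxSr.
have MZ_stable x : (MZ *m rho x <= MZ)%MS.
  have: forall y, y \in tval (vbasis Z) -> y \in Z by move=> y;
    apply: vbasis_mem.
  rewrite /MZ; elim: (tval (vbasis Z)) => [|y X IHX] XZ.
    by rewrite big_nil mul0mx sub0mx.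
  rewrite big_cons addsmxMr addsmxS //; last by apply: IHX => u uX; apply: XZ;
    rewrite inE uX orbT.
  have yZ : y \in Z by apply: XZ; rewrite mem_head.
  have -> : M *m rho y *m rho x = M *m rho x *m rho y.
    by rewrite -!mulmxA; congr (_ *m _); apply/esym/rep_central.
  exact: submxMr.
have M_MZ : (M <= MZ)%MS.
  apply: (nilpotent_nakayama k n (map rho b)) => //.
  - by move=> _ /mapP[x xb ->]; apply: nil_b.
  - by move=> _ /mapP[x xb ->].
  - by move=> _ /mapP[x xb ->].
  - by move=> _ _ /mapP[x xb ->] /mapP[y yb ->]; rewrite -rep M_Z.
apply/eqP; rewrite -submx0; apply: (nilpotent_nakayama k n (map rho (vbasis
  Z))).
- by move=> _ /mapP[x /vbasis_mem xZ ->]; apply: rep_central_nil.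
- by move=> a _; rewrite mul0mx.
- by move=> _ /mapP[x _ ->].
- by move=> _ _ /mapP[x /vbasis_mem xb ->] /mapP[y yb ->];
    rewrite -rep central // linear0 mulmx0.
- by rewrite big_map; apply: submx_trans M_MZ (addsmxSr _ _).
Qed.

(** The dimension estimate.  Call a vector good when no element of [cs] kills
    it, choose [v] good with [r = dim v Z] maximal, and complete [v g] to the
    whole space by [s] good vectors.

    These [s] vectors generate the representation, hence the central [Z]
    embeds in the sum of the spaces [w Z], each of dimension at most [r].

    A generic functional of the space turns [v] into a functional [l] of [g]
    that is nonzero on [cs], so that the radical of the form [l [x, y]] lies
    in [Z].  The stabiliser of [v] is isotropic for this form, and remains so
    when [Z] is added to it; this bounds its dimension from above, and the
    dimension of [v g] from below. *)
Lemma rep_dim_bound (cs : seq g) (rho : {linear g -> 'M[k]_n.+1}) :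
    {in cs, forall c, c \in Z /\ c != 0} ->
    (forall l : g -> k, scalar l -> {in cs, forall c, l c != 0} ->
      forall x, (forall y, l (lie x y) = 0) -> x \in Z) ->
    is_rep rho -> {in Z, forall z, rho z = 0 -> z = 0} ->
  exists r s, (\dim Z <= s * r)%N /\
    (\dim {:g} + 2 * (r + s) <= 2 * n.+1 + \dim Z)%N.
Proof.
move=> cs_Z crit rep0 inj0.
have [pi [b [rep piZ Zb nil_b]]] := nilpotent_twist rho rep0.
have inj z : z \in Z -> pi z = 0 -> z = 0 by move=> zZ; rewrite piZ //;
  apply: inj0.
pose ev v : 'Hom(g, 'rV[k]_n.+1) := linfun (mulmx v \o pi).
have evE v x : ev v x = v *m pi x by rewrite lfunE.
pose Us := [seq lker (linfun (mulmxr (pi c)) : 'Hom('rV[k]_n.+1, 'rV[k]_n.+1))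
  | c <- cs].
have properU : {in Us, forall U, U != fullv}.
  move=> _ /mapP[c c_cs ->]; have [cZ c0] := cs_Z c c_cs.
  apply: contraNneq c0 => ker_full; apply/eqP/inj => //.
  apply/row_matrixP => i; rewrite row0 rowE.
  have : (delta_mx 0 i : 'rV[k]_n.+1) \in fullv by apply: memvf.
  by rewrite -ker_full memv_ker lfunE => /eqP.
pose good (v : 'rV[k]_n.+1) := forall c, c \in cs -> v *m pi c != 0.
have avoid_good v : {in Us, forall U : {vspace 'rV[k]_n.+1}, v \notin U} ->
  good v.
  move=> v_Us c c_cs; have := v_Us _ (map_f _ c_cs).
  by rewrite memv_ker lfunE.
have [v good_v max_v] : exists2 v, good v & forall w, good w ->
  (\dim (ev w @: Z) <= \dim (ev v @: Z))%N.
  apply: (exists_max _ good (fun v => \dim (ev v @: Z)) (\dim Z)).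
    by have [v v_Us] := avoid_subspaces k _ Us char0 properU; exists v;
      apply: avoid_good.
  by move=> v _; rewrite -(limg_ker_dim (ev v) Z) leq_addl.
pose W := (limg (ev v))%VS.
have [vs [vs_Us gen size_vs]] := complement_avoiding k _ Us W char0 properU.
exists (\dim (ev v @: Z)), (size vs); split.
  rewrite -(size_map ev); apply: dim_le_sum_img.
    by move=> _ /mapP[w w_vs ->]; apply/max_v/avoid_good/vs_Us.
  move=> z zZ z0; apply: inj => //.
  apply: (nilrep_generators pi b v vs) => // w w_vs.
  by have := z0 _ (map_f ev w_vs); rewrite evE.
(* The column [u] is a functional on row vectors that vanishes on no [v c]
   with [c] in [cs]. *)
have [u u_cs] : exists u, {in [seq lker (linfun (mulmx (v *m pi c))
  : 'Hom('cV[k]_n.+1, 'M[k]_1)) | c <- cs],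
    forall U : {vspace 'cV[k]_n.+1}, u \notin U}.
  apply: avoid_subspaces => // _ /mapP[c c_cs ->].
  apply: contraNneq (good_v c c_cs) => ker_full.
  apply/eqP/rowP => i; rewrite mxE.
  have : (delta_mx i 0 : 'cV[k]_n.+1) \in fullv by apply: memvf.
  rewrite -ker_full memv_ker lfunE /= -colE => /eqP/matrixP/(_ 0 0).
  by rewrite !mxE.
pose l x := (v *m pi x *m u) 0 0.
have l_lin : scalar l.
  by move=> a x y; rewrite /l linearP mulmxDr mulmxDl -scalemxAr -scalemxAl
    !mxE.
have l_cs : {in cs, forall c, l c != 0}.
  move=> c c_cs; have := u_cs _ (map_f _ c_cs); rewrite memv_ker lfunE /=.
  apply: contra => /eqP lc0; apply/eqP/matrixP => i j.
  by rewrite !ord1 -[LHS]/(l c) lc0 mxE.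
pose B x y := l (lie x y).
have B_lker x y : x \in lker (ev v) -> y \in lker (ev v) -> B x y = 0.
  rewrite !memv_ker !evE => /eqP x0 /eqP y0.
  by rewrite /B /l rep mulmxBr !mulmxA x0 y0 !mul0mx subrr mul0mx mxE.
have lie_central x z : z \in Z -> lie x z = 0.
  move=> zZ; have := liexx (x + z).
  by rewrite lieDl !lieDr !liexx (central z x zZ) !addr0 add0r.
have iso : {in (lker (ev v) + Z)%VS &, forall x y, B x y = 0}.
  move=> _ _ /memv_addP[x xv [z zZ ->]] /memv_addP[y yv [t tZ ->]].
  rewrite /B lieDl !lieDr (lie_central x t tZ) !(fun y => central z y zZ)
    !addr0.
  exact: B_lker.
have := isotropic_dim k g B (lker (ev v) + Z)%VS Z.
have Bl y : scalar (B^~ y).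
  by move=> a x x'; rewrite /B lieDl lieZl l_lin.
have Br x : scalar (B x).
  by move=> a y y'; rewrite /B lieDr lieZr l_lin.
move=> /(_ Bl Br iso (crit l l_lin l_cs)).
have := dimv_sum_cap (lker (ev v)) Z; have := limg_ker_dim (ev v) Z.
have := limg_ker_dim (ev v) fullv; rewrite capfv capvC -/W.
move: size_vs; rewrite -/W dimvf [dim _]mul1n.
move: (\dim {:g}) (\dim Z) (\dim W) (\dim (_ + _)) (\dim (_ :&: _))
  (\dim (lker _)) (\dim (_ @: _)) (size vs).
by clear; lia.
Qed.
End TwoStepNilpotent.

(** * Divisors and minimal ideals *)

Section Socle.
Variable k : fieldType.

(** Up to associates, the list of the prime factors of [p], found by splitting
    [p] as long as it has a proper divisor. *)
Lemma prime_divisors (p : {poly k}) : p != 0 ->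
  exists ps : seq {poly k}, {in ps, forall q, q %| p /\ (1 < size q)%N} /\
    forall f, f %| p -> (1 < size f)%N -> exists2 q, q \in ps & q %| f.
Proof.
have [n] := ubnP (size p); elim: n p => // n IHn p; rewrite ltnS => le_p p0.
have [no_div|] := pselect (forall f, f %| p -> (1 < size f)%N -> p %| f).
  have [p1|p_gt1] := leqP (size p) 1.
    exists [::]; split=> // f f_p f1.
    by have := leq_trans f1 (leq_trans (dvdp_leq p0 f_p) p1).
  exists [:: p]; split=> [q|f f_p f1]; first by rewrite inE => /eqP->.
  by exists p; [rewrite mem_head | apply: no_div].
move=> /existsNP[f] /not_implyP[f_p] /not_implyP[f1 /negP pNf].
have f0 : f != 0 by rewrite -size_poly_gt0 ltnW.
have lt_f : (size f < size p)%N.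
  by rewrite ltn_neqAle dvdp_leq // dvdp_size_eqp // andbT /eqp f_p.
have Dp : p %/ f * f = p by rewrite divpK.
have q0 : p %/ f != 0 by apply: contraNneq p0 => q0; rewrite -Dp q0 mul0r.
have lt_q : (size (p %/ f)%R < size p)%N.
  rewrite size_divp // -subn1 ltn_subrL lt0n subn_eq0 -ltnNge f1.
  by rewrite size_poly_gt0.
have [ps [ps_f gen_f]] := IHn f (leq_trans lt_f le_p) f0.
have [qs [qs_q gen_q]] := IHn (p %/ f) (leq_trans lt_q le_p) q0.
exists (ps ++ qs); split=> [q|h h_p h1].
  rewrite mem_cat => /orP[/ps_f|/qs_q] [q_f q1]; split=> //.
    exact: dvdp_trans f_p.
  by rewrite (dvdp_trans q_f) // divp_dvd.
have [co_hf|] := boolP (coprimep h f).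
  have [|q q_qs q_h] := gen_q h _ h1.
    by rewrite -(@Gauss_dvdpl _ _ f) ?Dp.
  by exists q; rewrite // mem_cat q_qs orbT.
rewrite coprimep_def => ncop; have [||q q_ps q_h] := gen_f (gcdp h f).
- exact: dvdp_gcdr.
- rewrite ltn_neqAle eq_sym ncop size_poly_gt0 gcdp_eq0 negb_and.
  by rewrite f0 orbT.
by exists q; rewrite ?mem_cat ?q_ps // (dvdp_trans q_h) ?dvdp_gcdl.
Qed.

(** Every nonzero ideal of [k[t]/(p)] contains [p/q] for some prime factor [q]
    of [p]: these elements generate the minimal ideals. *)
Lemma socle_generators (p : {poly k}) : p != 0 ->
  exists cs : seq {poly k}, {in cs, forall c, ~~ (p %| c)} /\
    forall f, ~~ (p %| f) -> exists c h, c \in cs /\ p %| f * h - c.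
Proof.
move=> p0; have [ps [ps_p gen]] := prime_divisors p p0.
exists [seq p %/ q | q <- ps]; split=> [_ /mapP[q /ps_p[q_p q1] ->]|f pNf].
  have Dp : p %/ q * q = p by rewrite divpK.
  have q'0 : p %/ q != 0 by apply: contraNneq p0 => q0; rewrite -Dp q0 mul0r.
  apply/negP => /(dvdp_leq q'0); rewrite leqNgt size_divp;
    last by rewrite -size_poly_gt0 ltnW.
  rewrite -subn1 ltn_subrL lt0n subn_eq0 -ltnNge q1 size_poly_gt0.
  by rewrite p0.
set e := gcdp f p; have De : p %/ e * e = p by rewrite divpK ?dvdp_gcdr.
have e0 : e != 0 by rewrite gcdp_eq0 negb_and p0 orbT.
have p'0 : p %/ e != 0 by apply: contraNneq p0 => q0; rewrite -De q0 mul0r.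
have [||q q_ps /dvdpP[r Dr]] := gen (p %/ e).
- exact/divp_dvd/dvdp_gcdr.
- rewrite ltnNge; apply: contra pNf => p'1.
  rewrite -De (eqp_dvdl _ (eqp_mulr _ (_ : p %/ e %= 1))) ?mul1r ?dvdp_gcdl //.
  by rewrite -size_poly_eq1 eqn_leq p'1 size_poly_gt0.
have [q_p q1] := ps_p q q_ps; have q0 : q != 0 by rewrite -size_poly_gt0 ltnW.
have Dc : p %/ q = r * e by rewrite -{1}De Dr mulrAC mulpK.
have [[u w] /= /eqpf_eq[c c0 uw]] := Bezoutp f p.
exists (p %/ q), (c^-1 *: u * r); split; first exact: map_f.
have -> : f * (c^-1 *: u * r) - p %/ q = - (c^-1 *: w * r) * p;
  last exact: dvdp_mull.
rewrite Dc; suff -> : e = c^-1 *: u * f + c^-1 *: w * p by ring.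
by rewrite -!scalerAl -scalerDr uw scalerA mulVf // scale1r.
Qed.
End Socle.

(** * The centre of the current Heisenberg algebra *)

Section CurrentHeisenberg.
Variables (k : fieldType) (m : nat) (p : {poly k}).
Local Notation A := (pquot p).
Local Notation g := (current (heis k m) A : lieVectType k).
Local Notation "x \ox a" := (@tens k (heis k m) A x a : current (heis k m) A)
  (at level 40).

Lemma tens_eq0 (u : heis k m) (a : A) : u != 0 -> tens u a = 0 -> a = 0.
Proof.
move=> u0 ua0; have [i ui0] : exists i, coord (vbasis {:heis k m}) i u != 0.
  apply/existsP; apply: contraNT u0; rewrite negb_exists => /forallP u0.
  rewrite [u](coord_vbasis (memvf u)) big1 // => i _.
  by have := u0 i; rewrite negbK => /eqP->; rewrite scale0r.
rewrite [a](coord_vbasis (memvf a)) big1 // => j _.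
have /matrixP/(_ i j)/eqP := ua0;
  rewrite !mxE mulf_eq0 (negPf ui0) /= => /eqP->.
by rewrite scale0r.
Qed.

Definition heis_el (a b : 'I_m -> A) (c : A) : g :=
  \sum_i heisX k i \ox a i + \sum_i heisY k i \ox b i + heisZ k m \ox c.

Lemma tens0l (a : A) : tens (0 : heis k m) a = 0.
Proof. by rewrite -(scale0r (0 : heis k m)) tensZl scale0r. Qed.
Lemma tens0r (u : heis k m) : tens u (0 : A) = 0.
Proof. by rewrite -(scale0r (0 : A)) tensZr scale0r. Qed.

Lemma heis_elP (x : g) : exists a b c, x = heis_el a b c.
Proof.
elim/tens_ind: x => [u q|x y [a [b [c ->]]] [a' [b' [c' ->]]]].
  exists (fun i => u.1.1 0 i *: q), (fun i => u.1.2 0 i *: q), (u.2 *: q).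
  rewrite {1}[u]heis_decomp /heis_el !tensDl.
  have sumT (F : 'I_m -> heis k m) : tens (\sum_i F i) q = \sum_i tens (F i) q.
    by apply: (big_morph (fun u => tens u q)) => [v w|];
      rewrite ?tensDl ?tens0l.
  rewrite !sumT tensZl tensZr; congr (_ + _ + _);
    by apply: eq_bigr => i _; rewrite tensZl tensZr.
exists (fun i => a i + a' i), (fun i => b i + b' i), (c + c').
rewrite /heis_el tensDr !(eq_bigr _ (fun i _ => tensDr _ _ _)) !big_split /=.
by rewrite addrACA; congr (_ + _); rewrite addrACA.
Qed.

Lemma cmul_pi f h : cmul (pquot_pi p f) (pquot_pi p h) = pquot_pi p (f * h).
Proof. by rewrite pquot_piM. Qed.

Lemma lie_anti (L : lieAlgType k) (x y : L) : lie x y = - lie y x.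
Proof.
apply/eqP; rewrite -addr_eq0; apply/eqP.
by have := liexx (x + y); rewrite lieDl !lieDr !liexx add0r addr0.
Qed.

Lemma heis_lieYX i j : lie (heisY k i) (heisX k j)
  = - ((i == j)%:R *: heisZ k m).
Proof. by rewrite lie_anti heis_lieXY eq_sym. Qed.

Lemma current_lie_suml (F : 'I_m -> g) y : lie (\sum_i F i) y =
  \sum_i lie (F i) y.
Proof.
apply: (big_morph (fun x : g => lie x y)) => [x x'|]; first exact: lieDl.
by rewrite -(scale0r (0 : g)) lieZl !scale0r.
Qed.

Lemma lie_heis_elX a b c j q :
  lie (heis_el a b c) (heisX k j \ox q) = - (heisZ k m \ox cmul (b j) q).
Proof.
rewrite /heis_el !lieDl !current_lie_suml current_lie_tens heis_lieZ tens0l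
  addr0.
rewrite big1 ?add0r => [|i _];
  last by rewrite current_lie_tens heis_lieXX tens0l.
rewrite (bigD1 j) //= big1 => [|i ij]; rewrite current_lie_tens heis_lieYX.
  by rewrite eqxx addr0 scale1r -scaleN1r tensZl scaleN1r.
by rewrite (negPf ij) scale0r oppr0 tens0l.
Qed.

Lemma lie_heis_elY a b c j q :
  lie (heis_el a b c) (heisY k j \ox q) = heisZ k m \ox cmul (a j) q.
Proof.
rewrite /heis_el !lieDl !current_lie_suml current_lie_tens heis_lieZ tens0l
  addr0.
rewrite [X in _ + X]big1 ?addr0 => [|i _];
  last by rewrite current_lie_tens heis_lieYY tens0l.
rewrite (bigD1 j) //= big1 => [|i ij]; rewrite current_lie_tens heis_lieXY.
  by rewrite eqxx addr0 scale1r.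
by rewrite (negPf ij) scale0r tens0l.
Qed.

Definition centre_el (a : A) : g := tens (heisZ k m) a.
Let centre_el_linear : linear centre_el.
Proof. by move=> c a b; rewrite /centre_el tensDr tensZr. Qed.
HB.instance Definition _ := GRing.isSemilinear.Build k A g _ centre_el
  (GRing.semilinear_linear centre_el_linear).

Definition centre : {vspace g} := limg (linfun centre_el).

Lemma centreP (x : g) : reflect (exists a, x = heisZ k m \ox a) (x \in centre).
Proof.
apply: (iffP idP) => [/memv_imgP[a _ ->]|[a ->]]; first by exists a;
  rewrite lfunE.
have -> : heisZ k m \ox a = linfun centre_el a by rewrite lfunE.
exact/memv_img/memvf.
Qed.

Lemma heisZ_neq0 : heisZ k m != 0.
Proof. by apply/eqP => /(congr1 snd) /eqP; rewrite oner_eq0. Qed.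

Lemma dim_pquot : \dim {:A} = (size p).-1.
Proof. by rewrite dimvf. Qed.

Lemma dim_centre : \dim centre = (size p).-1.
Proof.
rewrite limg_dim_eq ?dim_pquot //; apply/eqP; rewrite -subv0; apply/subvP => a.
by rewrite memv_cap memv_ker lfunE memv0 =>
  /andP[_ /eqP /(tens_eq0 _ _ heisZ_neq0)->].
Qed.

Lemma dim_current : \dim {:g} = ((2 * m).+1 * (size p).-1)%N.
Proof. by rewrite dimvf /dim /= dim_pquot dimvf dim_heis. Qed.

Lemma centre_central (z x : g) : z \in centre -> lie z x = 0.
Proof.
case/centreP=> a ->; elim/tens_ind: x => [u q|x y IHx IHy].
  by rewrite current_lie_tens heis_lieZ tens0l.
by rewrite lieDr IHx IHy addr0.
Qed.

Lemma centre_derived (x y : g) : lie x y \in centre.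
Proof.
elim/tens_ind: x => [u q|x x' IHx IHx']; last by rewrite lieDl memvD.
elim/tens_ind: y => [v r|y y' IHy IHy']; last by rewrite lieDr memvD.
rewrite current_lie_tens heis_lieE; set s := \sum_i _; apply/centreP.
exists (s *: cmul q r); rewrite tensZr -tensZl; congr (tens _ _).
by rewrite /heisZ; congr (_, _, _); rewrite ?scaler0 //; apply: esym (mulr1 s).
Qed.

Lemma centre_bracket (m_gt0 : (0 < m)%N) (z : g) : z \in centre ->
  exists x y : g, z = lie x y.
Proof.
case/centreP=> a ->; pose i := Ordinal m_gt0.
exists (heisX k i \ox cone), (heisY k i \ox a).
by rewrite current_lie_tens heis_lieXY eqxx scale1r cmul1l.
Qed.

(** If a functional [l] of [k[t]/(p)] is nonzero on a generator of each minimal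
    ideal, then its kernel contains no nonzero ideal, so the form [l (x y)] is
    nondegenerate; hence so is the form that it induces on the span of the
    [X_i] and [Y_i] with coefficients in [k[t]/(p)]. *)
Lemma centre_critical : p != 0 -> exists cs : seq g,
  {in cs, forall c, c \in centre /\ c != 0} /\
  forall l : g -> k, scalar l -> {in cs, forall c, l c != 0} ->
    forall x, (forall y, l (lie x y) = 0) -> x \in centre.
Proof.
move=> p0; have [cs [cs0 gen]] := socle_generators k p p0.
exists [seq heisZ k m \ox pquot_pi p c | c <- cs]; split.
  move=> _ /mapP[c /cs0 pNc ->]; split; first by apply/centreP;
    exists (pquot_pi p c).
  apply: contraNneq pNc => /(tens_eq0 _ _ heisZ_neq0) c0.
  by rewrite -[c]subr0; apply/(pquot_pi_eq _ _ p0); rewrite c0 linear0.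
move=> l l_lin l_cs x; have [a [b [c ->]]] := heis_elP x => x_rad.
have lN y : l (- y) = - l y.
  have l0 : l 0 = 0 by have := l_lin (-1) 0 0;
    rewrite scaler0 addr0 mulN1r addNr.
  by have := l_lin (-1) y 0; rewrite scaleN1r !addr0 mulN1r l0 addr0.
have zero (f : A) : (forall q, l (heisZ k m \ox cmul f q) = 0) -> f = 0.
  move=> lf0; rewrite -[f]pquot_piK; apply/eqP; apply: contraT => f0.
  have [|d [h [d_cs dvd]]] := gen (polyn f).
    apply: contra f0 => pf; rewrite -(linear0 (pquot_pi p)); apply/eqP.
    by apply/(pquot_pi_eq _ _ p0); rewrite subr0.
  have /negP[] := l_cs _ (map_f (fun c => heisZ k m \ox pquot_pi p c) d_cs).
  have /(pquot_pi_eq _ _ p0) <- := dvd.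
  by rewrite -cmul_pi pquot_piK lf0.
have a0 i : a i = 0.
  by apply: zero => q; rewrite -(lie_heis_elY a b c) x_rad.
have b0 i : b i = 0.
  by apply: zero => q; apply: oppr_inj;
    rewrite -lN -(lie_heis_elX a b c) x_rad oppr0.
apply/centreP; exists c; rewrite /heis_el !big1 ?add0r // => i _.
  by rewrite b0 tens0r.
by rewrite a0 tens0r.
Qed.

End CurrentHeisenberg.

(** * The lower bound *)


Lemma faithful_rep_matrix (k : fieldType) (g : lieAlgType k) (n : nat)
  : has_faithful_rep g n ->
  exists M : {linear g -> 'M[k]_n},
    (forall x y, M (lie x y) = M x *m M y - M y *m M x) /\ injective M.
Proof.
move=> [V [rho [rho_lie rho_inj]]]; rewrite dimvf => dimV; case: n / dimV.
pose N x := lin1_mx (v2r \o rho x \o r2v).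
have NE u x : u *m N x = v2r (rho x (r2v u)) by rewrite mul_rV_lin1.
have N_lin : linear (fun x => - N x).
  move=> a x y; apply/row_matrixP => i.
  rewrite !rowE mulmxN mulmxDr -scalemxAr !mulmxN !NE linearP /=.
  by rewrite add_lfunE scale_lfunE linearP scalerN opprD.
(* Matrices act on row vectors from the right, which reverses products; the
   sign restores the bracket. *)
pose M : {linear g -> 'M[k]_(dim V)} :=
  HB.pack (fun x => - N x) (GRing.isLinear.Build k g _ _ _ N_lin).
exists M; split=> [x y|x y /=] /=.
  rewrite !mulmxN !mulNmx !opprK; apply/row_matrixP => i.
  rewrite !rowE mulmxN mulmxBr !mulmxA !NE !v2rK rho_lie -linearN -linearB;
    congr (v2r _).
  by rewrite /lie /= /gl_lie add_lfunE opp_lfunE !comp_lfunE opprB.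
move/oppr_inj => Nxy; apply: rho_inj; apply/lfunP => w.
by rewrite -[w]v2rK; apply: v2r_inj; rewrite -!NE Nxy.
Qed.

Lemma heisp_lower_bound (k : fieldType) (m : nat) (p : {poly k}) (n : nat) :
    [pchar k] =i pred0 -> (0 < m)%N -> p != 0 -> has_faithful_rep (heisp m p)
      n ->
  exists r s, ((size p).-1 <= s * r)%N /\ (m * (size p).-1 + (r + s) <= n)%N.
Proof.
move=> char0 m_gt0 p0 /faithful_rep_matrix[]; set d := (size p).-1.
pose g : lieVectType k := current (heis k m) (pquot p).
case: n => [|n] rho [rho_lie rho_inj].
  exists 0%N, 0%N; suff -> : d = 0 by rewrite !muln0.
  apply/eqP; rewrite /d -(dim_centre k m p) dimv_eq0 -subv0; apply/subvP => z _.
  rewrite memv0; apply/eqP; apply: (rho_inj (z : heisp m p) 0).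
  by apply/matrixP => - [].
have [cs [cs_Z crit]] := centre_critical k m p p0.
have [|z zZ z0|r [s [le_d le_n]]] :=
  rep_dim_bound k g (centre k m p) n char0 (centre_central k m p)
    (centre_derived k m p)
  (centre_bracket k m p m_gt0) cs rho cs_Z crit.
- exact: rho_lie.
- by apply: (rho_inj (z : heisp m p) 0); rewrite linear0.
exists r, s; move: le_d le_n; rewrite dim_centre dim_current -/d => le_d le_n;
  split=> //.
by move: le_n; rewrite mulSn -mulnA; lia.
Qed.

(** * The upper bound *)

Section UpperBound.
Variables (k : fieldType) (m : nat) (p : {poly k}) (a b : nat).
Hypothesis p0 : p != 0.
Local Notation d := (size p).-1.
Hypothesis le_d : (d <= a * b)%N.
Local Notation A := (pquot p).
Local Notation g := (current (heis k m) A : lieVectType k).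

Definition top_coef (x : A) : k := (polyn x)`_d.-1.

(** Multiplying [x] by the power of [t] that brings its leading term to degree
    [d - 1] involves no reduction modulo [p]. *)
Lemma top_coef_nondegenerate (x : A) :
  (forall e, (e < d)%N -> top_coef (cmul (pquot_pi p 'X^e) x) = 0) -> x = 0.
Proof.
move=> top0; apply/val_inj/eqP => /=; apply: contraT => x0.
have p_gt0 : (0 < size p)%N by rewrite size_poly_gt0.
have le_x : (size (polyn x) <= d)%N := size_npoly x.
have x_gt0 : (0 < size (polyn x))%N by rewrite size_poly_gt0.
have lt_e : (d - size (polyn x) < d)%N by lia.
have /eqP := top0 _ lt_e; rewrite /top_coef -[x]pquot_piK cmul_pi pquot_piE //.
rewrite pquot_piK modp_small; last first.
  by rewrite mulrC size_mulXn // subnK // ltn_predL.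
rewrite coefXnM ltnNge (_ : (_ - _ <= _)%N); last by lia.
rewrite (_ : (d.-1 - (d - size (polyn x)))%N = (size (polyn x)).-1);
  last by lia.
by rewrite -lead_coefE lead_coef_eq0 (negPf x0).
Qed.

(** With [A = k[t]/(p)], the space is [k^a + A^m + k^b]; the operators go from
    [k^b] to [A^m] (the [Y_i]), from [A^m] to [k^a] (the [X_i]) and from [k^b]
    to [k^a] ([Z]).  The last ones are faithful because the [a * b] products
    [t^i t^(a j)] run over [1, t, ..., t^(d - 1)]. *)
Definition rep_space : vectType k := ('rV[k]_a * {ffun 'I_m ->
  A} * 'rV[k]_b)%type.

Lemma dim_rep_space : dim rep_space = (m * d + (a + b))%N.
Proof.
have -> : dim rep_space = (dim 'rV[k]_a + #|'I_m| * d + dim 'rV[k]_b)%N by [].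
have dim_rV i : dim 'rV[k]_i = i by apply: mul1n.
by rewrite !dim_rV card_ord addnAC addnC.
Qed.

Definition row_of (x : A) : 'rV[k]_a := \row_i top_coef (cmul (pquot_pi p 'X^i)
  x).
Definition of_row (r : 'rV[k]_b) : A := \sum_j r 0 j *: pquot_pi p 'X^(a * j).

Definition op_fun (u : heis k m) (q : A) (w : rep_space) : rep_space :=
  (row_of (cmul q (\sum_l u.1.1 0 l *: w.1.2 l + u.2 *: of_row w.2)),
   [ffun l => u.1.2 0 l *: cmul q (of_row w.2)], 0).

Lemma cmulDr (x y z : A) : cmul x (y + z) = cmul x y + cmul x z.
Proof. by rewrite !(cmulC x) cmulDl. Qed.
Lemma cmulZr c (x y : A) : cmul x (c *: y) = c *: cmul x y.
Proof. by rewrite !(cmulC x) cmulZl. Qed.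

Lemma row_of_linear : linear row_of.
Proof.
by move=> c x y; apply/rowP => i;
  rewrite !mxE cmulDr cmulZr /top_coef /= coefD coefZ.
Qed.
Lemma of_row_linear : linear of_row.
Proof.
move=> c x y; rewrite /of_row scaler_sumr -big_split; apply: eq_bigr => j _ /=.
by rewrite !mxE scalerDl scalerA.
Qed.
HB.instance Definition _ := GRing.isSemilinear.Build k A 'rV[k]_a _ row_of
  (GRing.semilinear_linear row_of_linear).
HB.instance Definition _ := GRing.isSemilinear.Build k 'rV[k]_b A _ of_row
  (GRing.semilinear_linear of_row_linear).

Lemma rep_space_eq (v w : rep_space) : v.1.1 = w.1.1 -> v.1.2 = w.1.2 -> v.2 =
  w.2 -> v = w.
Proof. by case: v w => [[x y] z] [[x' y'] z'] /= -> -> ->. Qed.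

Lemma op_fun_linear u q : linear (op_fun u q).
Proof.
move=> c v w; apply: rep_space_eq => /=; last by rewrite scaler0 addr0.
  rewrite -row_of_linear; congr row_of; rewrite -cmulZr -cmulDr;
    congr (cmul q _).
  rewrite of_row_linear !scalerDr addrACA !scalerA (mulrC u.2)
    [c *: \sum_(l < m) _]scaler_sumr -big_split.
  congr (_ + _); apply: eq_bigr => l _ /=.
  by rewrite !ffunE scalerDr !scalerA mulrC.
apply/ffunP => l; rewrite !ffunE of_row_linear cmulDr cmulZr scalerDr !scalerA.
by rewrite mulrC.
Qed.
HB.instance Definition _ u q := GRing.isSemilinear.Build k rep_space rep_space
  _ (op_fun u q)
  (GRing.semilinear_linear (op_fun_linear u q)).

Definition op u q : gl rep_space := linfun (op_fun u q).

Lemma op_linear_l q : linear (op^~ q).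
Proof.
move=> c u v; apply/lfunP => w; rewrite add_lfunE scale_lfunE !lfunE /=.
apply: rep_space_eq => /=; last by rewrite scaler0 addr0.
  rewrite -row_of_linear; congr row_of; rewrite -cmulZr -cmulDr;
    congr (cmul q _).
  rewrite scalerDr [c *: \sum_(l < m) _]scaler_sumr scalerA addrACA -big_split
    -scalerDl.
  by congr (_ + _); apply: eq_bigr => l _ /=; rewrite !mxE scalerDl scalerA.
by apply/ffunP => l; rewrite !ffunE !mxE scalerDl scalerA.
Qed.

Lemma op_linear_r u : linear (op u).
Proof.
move=> c q r; apply/lfunP => w; rewrite add_lfunE scale_lfunE !lfunE /=.
apply: rep_space_eq => /=; last by rewrite scaler0 addr0.
  by rewrite -row_of_linear cmulDl cmulZl.
by apply/ffunP => l; rewrite !ffunE cmulDl cmulZl scalerDr !scalerA mulrC.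
Qed.

Lemma cmulr0 (x : A) : cmul x 0 = 0.
Proof. by rewrite -(scale0r (0 : A)) cmulZr !scale0r. Qed.

Lemma op_comp u q v r w : op_fun u q (op_fun v r w) =
  (row_of ((\sum_l u.1.1 0 l * v.1.2 0 l) *: cmul (cmul q r)
    (of_row w.2)), 0, 0).
Proof.
apply: rep_space_eq => //=; last by apply/ffunP => l;
  rewrite !ffunE linear0 cmulr0 scaler0.
congr row_of; rewrite linear0 scaler0 addr0 -cmulA -cmulZr scaler_suml.
by congr (cmul q _); apply: eq_bigr => l _; rewrite ffunE scalerA.
Qed.

Lemma op_lie u q v r : lie (op u q) (op v r) = op (lie u v) (cmul q r).
Proof.
apply/lfunP => w; rewrite /lie /= /gl_lie add_lfunE opp_lfunE !comp_lfunE
  !lfunE /=.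
rewrite !op_comp (cmulC r q); apply: rep_space_eq => /=.
- rewrite -linearB -scalerBl -sumrB [X in _ = row_of (cmul _ (X + _))]big1;
    last first.
    by move=> l _; rewrite mxE scale0r.
  by rewrite add0r cmulZr.
- by apply/ffunP => l; rewrite !ffunE mxE scale0r subrr.
- by rewrite subrr.
Qed.

Definition heis_rep (x : g) : gl rep_space := tlift op x.
Let heis_rep_linear : linear heis_rep.
Proof. exact: linearP. Qed.
HB.instance Definition _ := GRing.isSemilinear.Build k g (gl rep_space)
  _ heis_rep
  (GRing.semilinear_linear heis_rep_linear).

Lemma heis_rep_tens u q : heis_rep (tens u q) = op u q.
Proof. by apply: tlift_tens; [exact: op_linear_l | exact: op_linear_r]. Qed.

Let heis_repD x y : heis_rep (x + y) = heis_rep x + heis_rep y.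
Proof. exact: linearD. Qed.

Lemma heis_rep_lie (x y : g) : heis_rep (lie x y) = lie (heis_rep x)
  (heis_rep y).
Proof.
elim/tens_ind: x => [u q|x x' IHx IHx'];
  last by rewrite lieDl !heis_repD lieDl IHx IHx'.
elim/tens_ind: y => [v r|y y' IHy IHy'];
  last by rewrite lieDr !heis_repD lieDr IHy IHy'.
by rewrite current_lie_tens !heis_rep_tens op_lie.
Qed.

Lemma heis_rep_el f h z w : heis_rep (heis_el k m p f h z) w =
  (row_of (\sum_l cmul (f l) (w.1.2 l) + cmul z (of_row w.2)),
   [ffun l => cmul (h l) (of_row w.2)], 0).
Proof.
have sumE (F : 'I_m -> g) : heis_rep (\sum_i F i) w = \sum_i heis_rep (F i) w.
  by rewrite linear_sum sum_lfunE.
rewrite /heis_el !heis_repD !add_lfunE !sumE heis_rep_tens lfunE.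
have sum1 (F : 'I_m -> rep_space) : (\sum_i F i).1.1 = \sum_i (F i).1.1.
  by apply: (big_morph (fun v : rep_space => v.1.1)).
have sum2 (F : 'I_m -> rep_space) : (\sum_i F i).1.2 = \sum_i (F i).1.2.
  by apply: (big_morph (fun v : rep_space => v.1.2)).
have sum3 (F : 'I_m -> rep_space) : (\sum_i F i).2 = \sum_i (F i).2.
  by apply: (big_morph (fun v : rep_space => v.2)).
apply: rep_space_eq => /=.
- rewrite !sum1 [X in _ + X + _]big1 ?addr0 => [|i _]; last first.
    rewrite heis_rep_tens lfunE /= big1 ?add0r ?scale0r ?cmulr0 ?linear0 // =>
      l _.
    by rewrite mxE scale0r.
  rewrite [X in _ + row_of (cmul _ (X + _))]big1 ?add0r => [|l _];
    last by rewrite mxE scale0r.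
  rewrite scale1r linearD linear_sum; congr (_ + _); apply: eq_bigr => i _.
  rewrite heis_rep_tens lfunE /= scale0r addr0 (bigD1 i) //= big1 ?addr0 =>
    [|l li].
    by rewrite mxE !eqxx scale1r.
  by rewrite mxE eqxx (negPf li) scale0r.
- rewrite !sum2 [X in X + _ + _]big1 ?add0r => [|i _]; last first.
    by rewrite heis_rep_tens lfunE /=; apply/ffunP => l;
      rewrite !ffunE mxE scale0r.
  apply/ffunP => l; rewrite ffunE sum_ffunE !ffunE mxE scale0r addr0.
  rewrite (bigD1 l) //= big1 ?addr0 => [|i il];
    rewrite heis_rep_tens lfunE !ffunE mxE.
    by rewrite !eqxx scale1r.
  by rewrite eqxx eq_sym (negPf il) scale0r.
rewrite !sum3 !big1 ?addr0 // => i _; by rewrite heis_rep_tens lfunE.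
Qed.

Lemma heis_rep_injective : injective heis_rep.
Proof.
suff inj0 x : heis_rep x = 0 -> x = 0.
  move=> x y xy; apply/eqP; rewrite -subr_eq0; apply/eqP/inj0.
  by rewrite linearB /= xy subrr.
have [f [h [z ->]]] := heis_elP k m p x => rho0.
have rho_w w := congr1 (fun phi : gl rep_space => phi w) rho0.
have rowE (e : nat) (q : A) (e_lt : (e < a)%N) : row_of q = 0 ->
  top_coef (cmul (pquot_pi p 'X^e) q) = 0.
  by move/rowP/(_ (Ordinal e_lt)); rewrite !mxE.
have of_row_delta j : of_row (delta_mx 0 j) = pquot_pi p 'X^(a * j).
  rewrite /of_row (bigD1 j) //= big1 ?addr0 => [|i ij];
    first by rewrite mxE !eqxx scale1r.
  by rewrite mxE eqxx (negPf ij) scale0r.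
have f0 j : f j = 0.
  apply: top_coef_nondegenerate => e e_lt.
  have a_gt0 : (0 < a)%N by move: le_d e_lt; case: (a) => //; rewrite mul0n;
    lia.
  have := rho_w (0, [ffun i => if i == j then pquot_pi p 'X^e else 0], 0).
  rewrite heis_rep_el zero_lfunE => /(congr1 (fun w : rep_space => w.1.1))
    /= /(rowE 0%N _ a_gt0).
  rewrite linear0 cmulr0 addr0 (bigD1 j) //= big1 ?addr0 => [|i ij].
    by rewrite ffunE eqxx expr0 cmul1l cmulC.
  by rewrite ffunE (negPf ij) cmulr0.
have of_row_e (e : nat) : (e < d)%N -> exists i : 'I_a, exists j : 'I_b, e =
  (i + a * j)%N.
  move=> e_lt; have e_ab : (e < a * b)%N by apply: leq_trans le_d.
  have a_gt0 : (0 < a)%N by move: e_ab; case: (a).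
  exists (Ordinal (ltn_pmod e a_gt0)).
  have lt_b : (e %/ a < b)%N by rewrite ltn_divLR // mulnC.
  by exists (Ordinal lt_b); rewrite /= addnC mulnC -divn_eq.
have z0 : z = 0.
  apply: top_coef_nondegenerate => e /of_row_e[i [j ->]].
  have := rho_w (0, 0, delta_mx 0 j); rewrite heis_rep_el zero_lfunE.
  move=> /(congr1 (fun w : rep_space => w.1.1)) /=.
  rewrite of_row_delta big1 ?add0r => [|l _]; last by rewrite ffunE cmulr0.
  move/(rowE i _ (ltn_ord i)).
  by rewrite exprD -cmul_pi (cmulC z) cmulA.
have h0 l : h l = 0.
  apply: top_coef_nondegenerate => e e_lt.
  have b_gt0 : (0 < b)%N by move: le_d e_lt; case: (b) => //; rewrite muln0;
    lia.
  have := rho_w (0, 0, delta_mx 0 (Ordinal b_gt0));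
    rewrite heis_rep_el zero_lfunE.
  move=> /(congr1 (fun w : rep_space => w.1.2)) /ffunP/(_ l);
    rewrite /= !ffunE of_row_delta /=.
  by rewrite muln0 expr0 cmulC cmul1l => ->; rewrite cmulr0 /top_coef coef0.
rewrite /heis_el z0 tens0r addr0 !big1 ?addr0 // => i _.
  by rewrite h0 tens0r.
by rewrite f0 tens0r.
Qed.

Lemma heisp_upper_bound : has_faithful_rep (heisp m p) (m * d + (a + b)).
Proof.
exists rep_space, heis_rep; split;
  [exact: heis_rep_lie | exact: heis_rep_injective |].
by rewrite dimvf dim_rep_space.
Qed.
End UpperBound.

(** * The minimal dimension *)

(** The number [ceil (2 sqrt d)] is the least [n] with [4 d <= n^2]. *)
Lemma ceil_2sqrt_le (R : realType) (d n : nat) :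
  (`|Num.ceil (2 * Num.sqrt d%:R : R)| <= n)%N = (4 * d <= n * n)%N.
Proof.
set x := 2 * Num.sqrt d%:R; have x_ge0 : 0 <= x :> R by rewrite
  mulr_ge0 ?sqrtr_ge0.
have ceil_ge0 : (0 <= Num.ceil x)%R by rewrite -(ceil0 R) le_ceil.
rewrite -lez_nat gez0_abs // real_ceil_le_int ?num_real // -[n%:~R]/(n%:R : R).
rewrite -(@ler_pXn2r _ 2) ?nnegrE ?ler0n // exprMn sqr_sqrtr ?ler0n //.
by rewrite -!natrX -natrM ler_nat mulnn.
Qed.

Theorem mainTheorem1 (k : fieldType) (R : realType) (m : nat) (p : {poly k})
    (char0 : [pchar k] =i pred0) (m_gt0 : (0 < m)%N) (p_neq0 : p != 0) :
  let d := (size p).-1 in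
  is_mu (heisp m p) (m * d + `|Num.ceil (2 * Num.sqrt d%:R : R)|)%N.
Proof.
move=> d; set c := `|_|%N.
have c_le n : (c <= n)%N = (4 * d <= n * n)%N := ceil_2sqrt_le R d n.
split=> [|n /heisp_lower_bound[]// r [s [le_d le_n]]].
  (* For [c^2 >= 4 d], the two halves of [c] have a product of at least [d]. *)
  have le_cc := leqnn c; rewrite c_le in le_cc.
  have -> : c = (c./2 + uphalf c)%N by rewrite
    addnC uphalf_half -addnA addnn odd_double_half.
  apply: heisp_upper_bound => //; rewrite uphalf_half.
  move: le_cc; rewrite -{1 2}[c]odd_double_half -muln2.
  by case: (odd c); nia.
apply: leq_trans le_n; rewrite leq_add2l c_le.
apply: leq_trans (leq_mul (leqnn 4) le_d) _; rewrite -/d.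
by rewrite (mulnC s) mulnn nat_AGM2.
Qed.
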